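(* Consider the setting of the context and the estimator $\widehat f_{\widehat h_n}(t)$ with the data-driven bandwidth $\widehat h_n$ defined there, where the private observations $Z_{i,h}(t)$, $h\in\mathcal H_n$, are generated by the Laplace mechanism or by the Gaussian process mechanism with $\alpha'=\alpha/\#\mathcal H_n$ and $\beta'=\beta/\#\mathcal H_n$ in place of $\alpha$ and $\beta$. Then, uniformly for all $f$ with $\|f\|_\infty\le M$, $$\mathbf E\big[(\widehat f_{\widehat h_n}(t)-f(t))^2\big]\le C(a)\,v^2(h_n^\ast)\lambda^2(h_n^\ast).$$ As a consequence, taking $\overline h_n=1$, $$\mathbf E\big[(\widehat f_{\widehat h_n}(t)-f(t))^2\big]\le C(a)\,r_n(t,f).$$ Here $C(a)$ denotes a constant depending on $a$ (not necessarily the same in both bounds).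
   Context: Data: $X_1,\dots,X_n$ are i.i.d. real random variables with unknown density $f$; $t\in\mathbb R$ and $M>0$ are fixed. Kernel: $K:\mathbb R\to\mathbb R$ is bounded and square integrable with $\int K(u)\,du=1$ (the integral may be an improper one, as for $K(u)=\sin(\pi u)/(\pi u)$); $K_h(u)=\frac1hK(u/h)$. For the Gaussian process mechanism, $(x,y)\mapsto K(x-y)$ is in addition assumed to be a (symmetric) positive definite kernel. Bandwidth grid: $a>1$ is a fixed constant, $\overline h_n$ satisfies $a\log(\overline h_n\sqrt n)/\sqrt n\le\overline h_n\le1$, $\underline h_n=(\log(\overline h_n\sqrt n)\vee1)/\sqrt n$, and $$\mathcal H_n=\{h\in[\underline h_n,\overline h_n]:\ h=a^{-j}\overline h_n,\ j\in\mathbb N\},$$ where $\mathbb N$ includes $0$. Private observations: put $\alpha'=\alpha/\#\mathcal H_n$, $\beta'=\beta/\#\mathcal H_n$. For $h\in\mathcal H_n$, $i=1,\dots,n$, one of the following two mechanisms is used. (Laplace; $\alpha>0$, $\beta\in[0,1]$) $Z_{i,h}(t)=K_h(X_i-t)+\frac{C_{\alpha'\beta'}}{\sqrt2\,h}\xi_{i,h}$ with $C_{\alpha'\beta'}=\frac{2\sqrt2\,\|K\|_\infty}{\alpha'-\log(1-\beta')}$ and $\xi_{i,h}$ i.i.d. with density $\frac12e^{-|x|}$. (Gaussian process; $\alpha>0$, $\beta\in(0,1/2)$) $Z_{i,h}(t)=K_h(X_i-t)+\frac{C_{\alpha'\beta'}}{h}\Xi_{i,h}(t)$ with $C_{\alpha'\beta'}=\frac{\Delta'\sqrt{2\log(1/(2\beta'))+2\alpha'}}{\alpha'}$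 and $\Xi_{i,h}$ independent centred Gaussian processes with covariance kernel $(x,y)\mapsto K((x-y)/h)$. Here $\Delta'>0$ is a fixed constant depending only on $K$ that bounds, for all $x,x'\in\mathbb R$, the norm of $K((x-\cdot)/h)-K((x'-\cdot)/h)$ in the reproducing kernel Hilbert space of $(x,y)\mapsto K((x-y)/h)$. All noise variables are independent over $i$ and $h$ and independent of $X_1,\dots,X_n$. Estimators: $\widehat f_h(t)=\frac1n\sum_{i=1}^nZ_{i,h}(t)$, and $f_h(t)=\mathbf E[\widehat f_h(t)]=\int K_h(x-t)f(x)\,dx$ (the latter integral defines $f_h(t)$ for every $h>0$, and $f_0(t)=f(t)$). Further quantities (with $v(h),v(h,\eta)\ge0$): $$v^2(h)=\frac{M\int K^2(u)\,du}{nh}+\frac{C_{\alpha'\beta'}^2}{nh^2},\qquad \lambda(h)=\max\big(1,(\kappa\log(\overline h_n/h))^{1/2}\big),$$ $$v^2(h,\eta)=\frac Mn\int(K_h(u)-K_\eta(u))^2\,du+\frac{C_{\alpha'\beta'}^2}{nh^2}+\frac{C_{\alpha'\beta'}^2}{n\eta^2},\qquad \psi(h,\eta)=v(h)\lambda(h)+v(h,\eta)\lambda(\eta),$$ where $\kappa$ is a fixed sufficiently large constant. Oracle bandwidth: $$h_n^\ast=h_n^\ast(t,f)=\max\Big\{h\in\mathcal H_n:\ |f_\eta(t)-f(t)|\le\frac{v(h)\lambda(h)}2\ \text{for all }\eta\in\mathcal H_n,\ \eta\le h\Big\},$$ with $h_n^\ast=\underline h_n$ if this set is empty. Adaptive bandwidth: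 $$\widehat h_n=\max\big\{h\in\mathcal H_n:\ |\widehat f_h(t)-\widehat f_\eta(t)|\le\psi(h,\eta)\ \text{for all }\eta\in\mathcal H_n,\ \eta\le h\big\},$$ the maximum being taken over a non-empty set. Rate: $$r_n(t,f)=\inf_{\underline h_n\le h\le1}\Big[\sup_{0\le\eta\le h}(f_\eta(t)-f(t))^2+\frac{M\int K^2(u)\,du\,\log n}{nh}+\frac{C_{\alpha'\beta'}^2\log n}{nh^2}\Big].$$
   Formalization: Added assumption: at h = min H_n, |f_h(t)-f(t)| <= L v(h) lambda(h), with L arbitrary but fixed; the constants may depend on L, K, M and kappa besides a; the bound by r_n(t,f) is stated only for n >= 2, since log n = 0 at n = 1. *)

(* Defs.v *)
From HB Require Import structures.
From mathcomp Require Export all_boot all_order all_algebra.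
From mathcomp Require Export finmap.
From mathcomp Require Export all_classical all_reals all_analysis.

Set Implicit Arguments.
Unset Strict Implicit.
Unset Printing Implicit Defensive.

Import Order.TTheory GRing.Theory Num.Theory.
Import numFieldNormedType.Exports.

Local Open Scope classical_set_scope.
Local Open Scope ring_scope.

Section Kernels.
Context {R : realType}.
Implicit Types K f : R -> R.

Notation mu := (@lebesgue_measure R).

(* The total integral is the two-sided improper one, so that sinc-type kernels
   outside L^1 are allowed; the integrals over bounded intervals are ordinary
   Lebesgue integrals of a bounded measurable function. *)
Record is_kernel K : Prop := IsKernel {
  kernel_measurable : measurable_fun setT K;
  kernel_bounded : exists B, forall u, `|K u| <= B;
  kernel_square_integrable : mu.-integrable setT (fun u => (K u ^+ 2)%:E);
  kernel_integral1 :
    (fun p : R * R => \int[mu]_(u in `[p.1, p.2]) K u)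
      @ filter_prod (ninfty_nbhs R) (pinfty_nbhs R) --> (1 : R)
}.

Definition sup_norm K : R := sup (range (fun u => `|K u|)).

Definition L2sq K : R := \int[mu]_u (K u ^+ 2).

Definition Kh K (h u : R) : R := h^-1 * K (u / h).

(* f_h(t), with the convention f_0(t) = f(t) *)
Definition smooth K f (h t : R) : R :=
  if h == 0 then f t else \int[mu]_x (Kh K h (x - t) * f x).

Definition is_density f : Prop :=
  [/\ measurable_fun setT f, forall x, 0 <= f x
    & (\int[mu]_x (f x)%:E = 1)%E].

Definition pos_def_kernel (k : R -> R -> R) : Prop :=
  (forall x y, k x y = k y x) /\
  forall m (x c : 'I_m -> R),
    0 <= \sum_(i < m) \sum_(j < m) c i * c j * k (x i) (x j).

(* (H, ip) is the reproducing kernel Hilbert space of k (it is unique). *)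
Record is_rkhs (k : R -> R -> R) (H : set (R -> R))
    (ip : (R -> R) -> (R -> R) -> R) : Prop := IsRkhs {
  rkhs_lin : forall c g1 g2, H g1 -> H g2 -> H (cst c * g1 + g2);
  rkhs_ip_sym : forall g1 g2, H g1 -> H g2 -> ip g1 g2 = ip g2 g1;
  rkhs_ip_lin : forall c g1 g2 g3, H g1 -> H g2 -> H g3 ->
    ip (cst c * g1 + g2) g3 = c * ip g1 g3 + ip g2 g3;
  rkhs_ip_ge0 : forall g, H g -> 0 <= ip g g;
  rkhs_ip_def : forall g, H g -> ip g g = 0 -> g = cst 0;
  rkhs_complete : forall u : nat -> R -> R, (forall m, H (u m)) ->
    (forall e, 0 < e -> exists N, forall p q, (N <= p)%N -> (N <= q)%N ->
       ip (u p - u q) (u p - u q) < e) ->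
    exists2 g, H g & (fun m => ip (u m - g) (u m - g)) @ \oo --> (0 : R);
  rkhs_section : forall x, H (k x);
  rkhs_reproducing : forall g x, H g -> ip g (k x) = g x
}.

Definition scaled_kernel K (h x y : R) : R := K ((x - y) / h).

Definition rkhs_sensitivity_bound K (Delta : R) : Prop :=
  forall h : R, 0 < h -> forall H ip, is_rkhs (scaled_kernel K h) H ip ->
  forall x x' : R,
    Num.sqrt (ip (scaled_kernel K h x - scaled_kernel K h x')
                 (scaled_kernel K h x - scaled_kernel K h x')) <= Delta.

End Kernels.

Section Probability.
Context {R : realType} {d : measure_display} {T : measurableType d}.
Variable P : probability T R.

Definition has_density (X : T -> R) (f : R -> R) : Prop :=
  forall A : set R, measurable A ->
    (P (X @^-1` A) = \int[lebesgue_measure]_(x in A) (f x)%:E)%E.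

Definition indep_systems (I : choiceType) (D : set I)
    (G : I -> set (set T)) : Prop :=
  forall (J : {fset I}) (A : I -> set T), [set` J] `<=` D ->
    (forall k, k \in J -> G k (A k)) ->
    (P (\bigcap_(k in [set` J]) A k) = \prod_(k <- J) P (A k))%E.

Definition process_salgebra (I : Type) (Y : I -> T -> R) : set (set T) :=
  <<s \bigcup_i g_sigma_algebra_preimage (Y i) >>.

(* N(0, s2); the library's normal_prob is not a point mass at s2 = 0. *)
Definition centred_gaussian (s2 : R) (A : set R) : \bar R :=
  if s2 == 0 then dirac (0 : R) A else normal_prob 0 (Num.sqrt s2) A.

Definition centred_gaussian_process (Y : R -> {RV P >-> R})
    (k : R -> R -> R) : Prop :=
  forall m (x c : 'I_m -> R) (A : set R), measurable A ->
    P ((fun w => \sum_(i < m) c i * Y (x i) w) @^-1` A) =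
    centred_gaussian (\sum_(i < m) \sum_(j < m) c i * c j * k (x i) (x j)) A.

End Probability.

Inductive mechanism := Laplace | GaussianProcess.

Section Procedure.
Context {R : realType}.
Implicit Types (K f : R -> R) (a M hbar kappa c h eta t : R) (n : nat).

Notation mu := (@lebesgue_measure R).

Definition hlow hbar n : R :=
  Num.max (ln (hbar * Num.sqrt n%:R)) 1 / Num.sqrt n%:R.

Definition grid a hbar n : set R :=
  [set h | hlow hbar n <= h <= hbar /\ exists j : nat, h = a ^- j * hbar].

(* #H_n; the grid is finite for a > 1 *)
Definition grid_card a hbar n : nat := #|` fset_set (grid a hbar n)|.

(* For beta' = 1 one has log(1 - beta') = -oo, i.e. no noise at all
   (the library sets ln 0 = 0). *)
Definition laplace_const K (alpha beta : R) : R :=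
  if beta == 1 then 0
  else 2 * Num.sqrt 2 * sup_norm K / (alpha - ln (1 - beta)).

Definition gaussian_const (Delta alpha beta : R) : R :=
  Delta * Num.sqrt (2 * ln (1 / (2 * beta)) + 2 * alpha) / alpha.

Definition noise_const (m : mechanism) K (Delta alpha beta : R) : R :=
  match m with
  | Laplace => laplace_const K alpha beta
  | GaussianProcess => gaussian_const Delta alpha beta
  end.

Definition admissible (m : mechanism) K (Delta alpha beta : R) : Prop :=
  match m with
  | Laplace => 0 < alpha /\ 0 <= beta <= 1
  | GaussianProcess =>
      [/\ 0 < alpha, 0 < beta < 1 / 2, 0 < Delta,
          pos_def_kernel (fun x y => K (x - y))
        & rkhs_sensitivity_bound K Delta]
  end.

Section Observations.
Context {d : measure_display} {T : measurableType d}.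
Variable P : probability T R.

Definition iid_sample n f (X : 'I_n -> {RV P >-> R}) : Prop :=
  (forall i, has_density P (X i) f) /\
  indep_systems P setT (fun i => g_sigma_algebra_preimage (X i)).

(* Independence of all the X_i (index inl i) and all the noise variables or
   noise processes (index inr (i, h), h in Hn). *)
Definition indep_noise n (Hn : set R) (X : 'I_n -> {RV P >-> R})
    (G : 'I_n -> R -> set (set T)) : Prop :=
  indep_systems P
    [set k : 'I_n + 'I_n * R | if k is inr ih then Hn ih.2 else True]
    (fun k => match k with
              | inl i => g_sigma_algebra_preimage (X i)
              | inr ih => G ih.1 ih.2
              end).

Definition laplace_observations n (Hn : set R) K c t
    (X : 'I_n -> {RV P >-> R}) (Z : 'I_n -> R -> T -> R) : Prop :=
  exists xi : 'I_n -> R -> {RV P >-> R},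
  [/\ forall i h, Hn h ->
        has_density P (xi i h) (fun x => expR (- `|x|) / 2),
      indep_noise Hn X (fun i h => g_sigma_algebra_preimage (xi i h))
    & forall i h w, Hn h ->
        Z i h w = Kh K h (X i w - t) + c / (Num.sqrt 2 * h) * xi i h w].

Definition gaussian_observations n (Hn : set R) K c t
    (X : 'I_n -> {RV P >-> R}) (Z : 'I_n -> R -> T -> R) : Prop :=
  exists Xi : 'I_n -> R -> R -> {RV P >-> R},
  [/\ forall i h, Hn h ->
        centred_gaussian_process (Xi i h) (scaled_kernel K h),
      indep_noise Hn X
        (fun i h => process_salgebra (fun x => Xi i h x : T -> R))
    & forall i h w, Hn h ->
        Z i h w = Kh K h (X i w - t) + c / h * Xi i h t w].

Definition private_observations (m : mechanism) :=
  match m with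
  | Laplace => laplace_observations
  | GaussianProcess => gaussian_observations
  end.

Definition fhat n (Z : 'I_n -> R -> T -> R) h (w : T) : R :=
  n%:R^-1 * \sum_(i < n) Z i h w.

End Observations.

(* In all that follows, c stands for C_{alpha' beta'}. *)

Definition v K M c n h : R :=
  Num.sqrt (M * L2sq K / (n%:R * h) + c ^+ 2 / (n%:R * h ^+ 2)).

Definition v2 K M c n h eta : R :=
  Num.sqrt (M / n%:R * \int[mu]_u ((Kh K h u - Kh K eta u) ^+ 2)
            + c ^+ 2 / (n%:R * h ^+ 2) + c ^+ 2 / (n%:R * eta ^+ 2)).

Definition lambda kappa hbar h : R :=
  Num.max 1 (Num.sqrt (kappa * ln (hbar / h))).

Definition psi K M c n kappa hbar h eta : R :=
  v K M c n h * lambda kappa hbar h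
  + v2 K M c n h eta * lambda kappa hbar eta.

(* Maxima over subsets of the grid are written sup: the sets are finite. *)

Definition oracle_set K M c n kappa a hbar f t : set R :=
  [set h | grid a hbar n h /\
     forall eta, grid a hbar n eta -> eta <= h ->
       `|smooth K f eta t - f t| <= v K M c n h * lambda kappa hbar h / 2].

Definition hstar K M c n kappa a hbar f t : R :=
  if pselect (oracle_set K M c n kappa a hbar f t !=set0)
  then sup (oracle_set K M c n kappa a hbar f t)
  else hlow hbar n.

Definition hhat (T : Type) K M c n kappa a hbar
    (fh : R -> T -> R) (w : T) : R :=
  sup [set h | grid a hbar n h /\
     forall eta, grid a hbar n eta -> eta <= h ->
       `|fh h w - fh eta w| <= psi K M c n kappa hbar h eta].

Definition rate K M c n f t : \bar R :=
  ereal_inf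
    [set (ereal_sup [set ((smooth K f eta t - f t) ^+ 2)%:E
                    | eta in `[0%R, h]]
          + (M * L2sq K * ln n%:R / (n%:R * h)
             + c ^+ 2 * ln n%:R / (n%:R * h ^+ 2))%:E)%E
    | h in `[hlow 1 n, 1%R]].

(* The bias at the smallest grid point is at most L times v * lambda there.
   As v * lambda is nonincreasing, the case L = 1/2 says exactly that
   oracle_set is nonempty; for larger L, oracle_set may be empty. *)
Definition initial_bias_le (L : R) K M c n kappa a hbar f t : Prop :=
  forall h, grid a hbar n h -> (forall eta, grid a hbar n eta -> h <= eta) ->
    `|smooth K f h t - f t| <= L * (v K M c n h * lambda kappa hbar h).

End Procedure.

(* Main.v *)
(** Lepski's method. At the oracle bandwidth H the bias is dominated by
    v(H) lambda(H). If the selected bandwidth is at least H, its very definition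
    bounds the distance of its estimator to the one at H. If it is some h < H,
    then the next larger grid point a h <= H was rejected in favour of some
    eta < a h; as the biases at a h and eta are small, the centred estimators at
    a h and eta differ by more than v(a h, eta) lambda(eta), an event of probability
    polynomially small in eta / hbar, with an exponent growing with kappa. This
    beats the growth v^2(h) <= (H / h)^2 v^2(H) of the variance, and the sum over
    all pairs h, eta on the grid is geometric.

    All probabilistic input is a bound E exp(theta S) <= exp(A theta^2 V^2) for the
    centred estimators and their differences, on a range of theta wide enough for
    deviations of order sqrt(log(hbar / eta)) V. It holds since n eta dominates
    log(hbar / eta) on the grid and since the squared L2 distance between K_h and
    K_eta is at least a constant times 1 / eta as soon as a eta <= h. Moments are
    in turn dominated by exponentials. *)
From HB Require Import structures.
From mathcomp Require Import ring lra measurable_realfun.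
Require Import Defs.
Import Order.TTheory GRing.Theory Num.Theory.
Import numFieldNormedType.Exports.
Local Open Scope classical_set_scope.
Local Open Scope ring_scope.

Set Implicit Arguments.
Unset Strict Implicit.
Unset Printing Implicit Defensive.

(** * Integration *)

(** The selected bandwidth is random, so a moment bound at a fixed bandwidth does not apply to it.
    Its error is bounded pointwise by a finite sum over all pairs of a selected index and a witness
    of rejection, and each summand by an explicit combination of exponentials. Measurability is thus
    asked of the majorants only, not of the estimator at [hhat]. The exponents fit together as
    follows. For a pair j <= l the factor [a^-1 ^+ l] occurs to the power 4: two powers pay for the
    variance growth [(a ^+ j) ^+ 2], and one each is left for the geometric sums over j and l.
    Splitting a product of error and event halves the exponent of the event, whose bound must
    therefore be of order [(a^-1 ^+ l) ^+ 8]; this 8 enters the lower bound on [kappa]. Exponential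
    arguments are measured in units of V, which is [v] or [v2]. The scale [tau] then depends on K, a
    and M alone, and the noise level c enters only through V, so that the constants are the same for
    both mechanisms and all privacy levels. *)

Section IntegralTransfer.
Local Open Scope ereal_scope.
Context {R : realType} d3 (S : measurableType d3).
Import HBNNSimple.

(** The approximating simple functions are built from [phi] alone. Hence the limit depends on [m],
    [Y] and [H] only through the integrals of [H] over preimages under [Y]. *)
Lemma ge0_integral_comp_weight d (T : measurableType d)
    (m : {measure set T -> \bar R}) (Y : T -> S) (H : T -> R)
    (phi : S -> \bar R) :
  measurable_fun setT Y -> measurable_fun setT H -> (forall x, (0 <= H x)%R) ->
  forall mphi : measurable_fun setT phi, (forall y, 0 <= phi y) ->
  let g := nnsfun_approx measurableT mphi in
  \int[m]_x (phi (Y x) * (H x)%:E) =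
  limn (fun n => \sum_(r \in range (g n))
          r%:E * \int[m]_(x in Y @^-1` (g n @^-1` [set r])) (H x)%:E).
Proof.
move=> mY mH H0 mphi phi0 g.
have mgY n : measurable_fun setT (fun x => g n (Y x)).
  by apply: measurableT_comp => //; exact: measurable_funP.
transitivity (limn (fun n => \int[m]_x ((g n (Y x))%:E * (H x)%:E))).
  rewrite -monotone_convergence//; last 3 first.
  - move=> n; apply: emeasurable_funM; first exact/measurable_EFinP/mgY.
    exact/measurable_EFinP.
  - by move=> n x _; rewrite mule_ge0// lee_fin.
  - move=> x _ a b ab; rewrite lee_wpmul2r ?lee_fin//.
    exact/lefP/nd_nnsfun_approx.
  apply: eq_integral => x _; apply/esym/cvg_lim => //.
  apply: cvgeZr => //.
  by apply: cvg_nnsfun_approx.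
congr (limn _); apply/funext => n.
have mE r : measurable (Y @^-1` (g n @^-1` [set r])).
  by rewrite -[X in measurable X]setTI; apply: mY.
transitivity (\int[m]_x \sum_(r \in range (g n))
    (r%:E * (\1_(Y @^-1` (g n @^-1` [set r])) x * H x)%:E)).
  apply: eq_integral => x _.
  rewrite fimfunE -fsumEFin// ge0_mule_fsuml; last first.
    by move=> r; exact: nnfun_muleindic_ge0.
  by apply: eq_fsbigr => r _; rewrite !EFinM muleA.
rewrite ge0_integral_fsum//; last 2 first.
- move=> r; apply/measurable_funeM/measurable_EFinP/measurable_funM => //.
- move=> r x _; have [<-|/eqP nr] := eqVneq (g n (Y x)) r.
    by rewrite mule_ge0// lee_fin// mulr_ge0.
  by rewrite indicE memNset ?mul0r ?mule0.
apply: eq_fsbigr => r /set_mem[y _ <-].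
rewrite ge0_integralZl//; last 3 first.
- apply/measurable_EFinP/measurable_funM => //.
- by move=> x _; rewrite lee_fin mulr_ge0.
- by rewrite lee_fin.
rewrite [in RHS]integral_mkcond; congr (_ * _).
by apply: eq_integral => x _; rewrite epatch_indic -EFinM mulrC.
Qed.

(** A general change of variables. It serves for densities ([H1] = 1, [Y2] the identity, [H2] = f),
    for a point mass, and, with the same variable on both sides, for passing from events to
    functions under independence. *)
Lemma ge0_integral_transfer d1 (T1 : measurableType d1) d2
    (T2 : measurableType d2) (m1 : {measure set T1 -> \bar R})
    (m2 : {measure set T2 -> \bar R}) (Y1 : T1 -> S) (Y2 : T2 -> S)
    (H1 : T1 -> R) (H2 : T2 -> R) :
  measurable_fun setT Y1 -> measurable_fun setT Y2 ->
  measurable_fun setT H1 -> measurable_fun setT H2 ->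
  (forall x, (0 <= H1 x)%R) -> (forall x, (0 <= H2 x)%R) ->
  (forall B, measurable B -> \int[m1]_(x in Y1 @^-1` B) (H1 x)%:E =
                             \int[m2]_(x in Y2 @^-1` B) (H2 x)%:E) ->
  forall phi : S -> \bar R, measurable_fun setT phi -> (forall y, 0 <= phi y) ->
  \int[m1]_x (phi (Y1 x) * (H1 x)%:E) = \int[m2]_x (phi (Y2 x) * (H2 x)%:E).
Proof.
move=> mY1 mY2 mH1 mH2 H10 H20 H12 phi mphi phi0.
rewrite (@ge0_integral_comp_weight _ _ m1 _ _ _ mY1 mH1 H10 mphi)//.
rewrite (@ge0_integral_comp_weight _ _ m2 _ _ _ mY2 mH2 H20 mphi)//.
congr (limn _); apply/funext => n; apply: eq_fsbigr => r _.
by rewrite H12.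
Qed.

(* As the integral is a supremum over simple functions below the integrand,
   the smaller function need not be measurable. *)
Lemma ge0_le_integral_nomeas d (T : measurableType d)
    (m : {measure set T -> \bar R}) (f g : T -> \bar R) :
  (forall x, 0 <= f x) -> (forall x, f x <= g x) ->
  \int[m]_x f x <= \int[m]_x g x.
Proof.
move=> f0 fg; have g0 x : 0 <= g x by exact: le_trans (fg x).
rewrite !ge0_integralTE//; apply: le_ereal_sup => _ [h hf <-].
by exists h => // x; exact: le_trans (fg x).
Qed.

End IntegralTransfer.

(** * Expectations of products of independent variables *)

Section Independence.
Context {R : realType} d (T : measurableType d) (P : probability T R).

(** Independence is given for events. In the claim [gen] the indices of [s1] carry functions and
    those of [s2] carry events; the induction on [s1] moves one index at a time to the event list,
    until only events are left. *)
Lemma indep_ge0_integral_prod (I : choiceType) (D : set I) (Y : I -> T -> R)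
    (phi : I -> R -> R) (e : I -> R) :
  (forall k, measurable_fun setT (Y k)) ->
  indep_systems P D (fun k => g_sigma_algebra_preimage (Y k)) ->
  (forall k, measurable_fun setT (phi k)) -> (forall k x, 0 <= phi k x) ->
  forall s : seq I, uniq s -> (forall k, k \in s -> D k) ->
  (forall k, k \in s -> (\int[P]_w (phi k (Y k w))%:E = (e k)%:E)%E) ->
  (\int[P]_w (\prod_(k <- s) phi k (Y k w))%:E = (\prod_(k <- s) e k)%:E)%E.
Proof.
move=> mY indY mphi phi0 s us sD es.
have mpre k (B : set R) : measurable B -> measurable (Y k @^-1` B).
  by move=> mB; rewrite -[X in measurable X]setTI; exact: mY.
have mbig (s1 : seq I) :
    measurable_fun setT (fun w => \prod_(k <- s1) phi k (Y k w)).
  by apply: measurable_prod => k _; exact: measurableT_comp.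
suff gen (s1 s2 : seq I) (B : I -> set R) : uniq (s1 ++ s2) ->
    (forall k, k \in s1 ++ s2 -> D k) ->
    (forall k, k \in s1 -> (\int[P]_w (phi k (Y k w))%:E = (e k)%:E)%E) ->
    (forall k, measurable (B k)) ->
    (\int[P]_(w in \bigcap_(k in [set` s2]) Y k @^-1` B k)
       (\prod_(k <- s1) phi k (Y k w))%:E =
     (\prod_(k <- s1) e k)%:E * \prod_(k <- s2) P (Y k @^-1` B k))%E.
  have := gen s [::] (fun=> setT); rewrite cats0 big_nil mule1 => <- //.
  by congr (integral _ _ _); apply/seteqP; split.
elim: s1 s2 B => [|k s1 IH] s2 B /= us12 D12 e1 mB.
  under eq_integral do rewrite big_nil.
  rewrite integral_cst; last first.
    by apply: fin_bigcap_measurable => // k _; exact: mpre.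
  rewrite big_nil !mul1e.
  have := indY [fset k in s2]%fset (fun k => Y k @^-1` B k) _ _.
  rewrite (_ : [set` [fset k in s2]%fset] = [set` s2]); last first.
    by apply/seteqP; split => x /=; rewrite in_fset.
  move=> indB; apply: etrans; first apply: indB.
  - by move=> j /=; exact: D12.
  - move=> j _; rewrite /g_sigma_algebra_preimage /preimage_set_system/=.
    by exists (B j) => //; rewrite setTI.
  apply: perm_big; apply: uniq_perm => //.
  by move=> x; rewrite in_fset.
move: us12 => /andP[knin us12].
have ks2 : k \notin s2 by move: knin; rewrite mem_cat negb_or => /andP[].
set A := \bigcap_(j in _) _.
have mA : measurable A by apply: fin_bigcap_measurable => // j _; exact: mpre.
pose C := fine ((\prod_(j <- s1) e j)%:E * \prod_(j <- s2) P (Y j @^-1` B j))%E.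
have prodfin : (\prod_(j <- s2) P (Y j @^-1` B j))%E \is a fin_num.
  elim: (s2) => [|j l IHl]; first by rewrite big_nil.
  by rewrite big_cons fin_numM// fin_num_measure//; exact: mpre.
have e0 j : j \in k :: s1 -> 0 <= e j.
  by move=> js; rewrite -lee_fin -e1// integral_ge0// => w _; rewrite lee_fin.
have CE : C%:E = ((\prod_(j <- s1) e j)%:E *
    \prod_(j <- s2) P (Y j @^-1` B j))%E.
  by rewrite fineK// fin_numM.
have C0 : 0 <= C.
  rewrite -lee_fin CE mule_ge0//; last by apply: prode_ge0.
  rewrite lee_fin big_seq prodr_ge0// => j js.
  by apply: e0; rewrite inE js orbT.
(* The two weights are the rest of the product on [A] and its claimed mean [C]. They have the same
   integral over every preimage under [Y k], by the induction hypothesis with [k] moved to the event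
   list. *)
have key := @ge0_integral_transfer R _ R _ T _ T P P (Y k) (Y k)
  (fun w => \1_A w * \prod_(j <- s1) phi j (Y j w)) (cst C).
transitivity (\int[P]_w ((phi k (Y k w))%:E * C%:E))%E; last first.
  rewrite ge0_integralZr//; last 2 first.
  - by apply/measurable_EFinP; exact: measurableT_comp.
  - by move=> w _; rewrite lee_fin.
  by rewrite e1 ?mem_head// big_cons EFinM -muleA CE.
have -> : (\int[P]_w ((phi k (Y k w))%:E * C%:E) =
   \int[P]_w ((EFin \o phi k) (Y k w) * (cst C w)%:E))%E by [].
rewrite -key//; last 5 first.
- by apply: measurable_funM => //; exact: measurable_indic.
- by move=> w; rewrite mulr_ge0// prodr_ge0.
- move=> B' mB'.
  have -> : (\int[P]_(x in Y k @^-1` B') (cst C x)%:E =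
             C%:E * P (Y k @^-1` B'))%E by rewrite -integral_cst//; exact: mpre.
  pose B2 j := if j == k then B' else B j.
  have Beq j : j \in s2 -> B2 j = B j.
    by rewrite /B2; case: eqP => // -> ks; rewrite ks in ks2.
  have := IH (k :: s2) B2.
  rewrite big_cons /B2 eqxx -/B2 muleCA.
  have -> : (\prod_(j <- s2) P (Y j @^-1` B2 j) =
             \prod_(j <- s2) P (Y j @^-1` B j))%E.
    by apply: eq_big_seq => j /Beq ->.
  rewrite -CE [(C%:E * _)%E]muleC => <-; last 4 first.
  - by rewrite uniq_catC /= mem_cat orbC -mem_cat knin uniq_catC.
  - by move=> j; rewrite mem_cat inE => jin; apply: D12; rewrite inE mem_cat;
      case/or3P: jin => ->; rewrite ?orbT.
  - by move=> j js; apply: e1; rewrite inE js orbT.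
  - by move=> j; rewrite /B2; case: ifP.
  rewrite [LHS]integral_mkcond [RHS]integral_mkcond; apply: eq_integral => w _.
  rewrite !patchE indicE.
  have -> : (w \in \bigcap_(j in [set` k :: s2]) Y j @^-1` B2 j) =
            (w \in Y k @^-1` B') && (w \in A).
    apply/idP/andP => [/set_mem wB|[/set_mem wk /set_mem wA]].
      split; apply/mem_set.
        by have := wB k; rewrite /= /B2 eqxx mem_head; exact.
      move=> j /= js; rewrite -Beq//; apply: wB => /=.
      by rewrite inE js orbT.
    apply/mem_set => j /=; rewrite inE => /orP[/eqP ->|js].
      by rewrite /B2 eqxx.
    by rewrite Beq//; exact: wA.
  by case: (w \in Y k @^-1` B'); case: (w \in A); rewrite /= ?mul1r ?mul0r.
- exact/measurable_EFinP.
- by move=> x; rewrite lee_fin.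
rewrite [LHS]integral_mkcond; apply: eq_integral => w _; rewrite patchE /= indicE.
by case: (w \in A); rewrite ?mul1r ?mul0r ?mule0// big_cons EFinM.
Qed.

End Independence.

(** * Exponential moments *)

Section Laws.
Context {R : realType}.
Notation mu := (@lebesgue_measure R).

(** The image of Lebesgue measure under the affine map, multiplied by [h^-1], gives every half-open
    interval its length, so it is Lebesgue measure by uniqueness. *)
Lemma ge0_integral_lebesgue_affine (h t : R) (phi : R -> \bar R) : 0 < h ->
  measurable_fun setT phi -> (forall x, (0 <= phi x)%E) ->
  (\int[mu]_x phi ((x - t) / h)%R = h%:E * \int[mu]_x phi x)%E.
Proof.
move=> h0 mphi phi0.
pose Y (x : measurableTypeR R) : measurableTypeR R := ((x : R) - t) / h.
have mY : measurable_fun setT Y.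
  have : measurable_fun setT (fun x : R => (x - t) / h).
    by apply: measurable_funM => //; exact: measurable_funB.
  by [].
have hV0 : 0 <= h^-1 by rewrite invr_ge0 ltW.
have [pf pfE] : exists pf : {measure set (measurableTypeR R) -> \bar R},
    forall A, pf A = pushforward mu Y A by exists (pushforward mu Y).
pose nu := mscale (NngNum hV0) pf.
have nuE A : measurable A -> mu A = nu A.
  move=> mA; apply: (@lebesgue_measure_unique R nu) => // _ [[x y] _ <-] /=.
  rewrite /nu /mscale /= pfE /pushforward.
  have -> : Y @^-1` [set` `]x, y]] = [set` `]x * h + t, y * h + t]].
    apply/seteqP; split => z /=; rewrite !in_itv /= /Y;
      by rewrite ltr_pdivlMr// ler_pdivrMr// ltrBrDr lerBlDr.
  rewrite !lebesgue_measure_itv /= !lte_fin ltrD2r ltr_pM2r//.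
  case: ifP => _; last by rewrite mule0.
  rewrite -!EFinB -EFinM; congr EFin.
  by rewrite opprD addrACA subrr addr0 -mulrBl mulrC mulfK// gt_eqF.
have -> : (\int[mu]_x phi x = \int[nu]_x phi x)%E.
  by apply: eq_measure_integral => A mA _; exact: nuE.
rewrite ge0_integral_mscale//= muleA -EFinM divff ?gt_eqF// mul1e.
rewrite [RHS](eq_measure_integral (pushforward mu Y)) => [|A _ _]; last exact: pfE.
by rewrite ge0_integral_pushforward.
Unshelve. all: exact: mY.
Qed.

Lemma ge0_integral_lebesgueN (phi : R -> \bar R) :
  measurable_fun setT phi -> (forall x, (0 <= phi x)%E) ->
  (\int[mu]_x phi (- x)%R = \int[mu]_x phi x)%E.
Proof.
move=> mphi phi0.
transitivity (\int[pushforward mu (-%R : _ -> measurableTypeR R)]_x phi x)%E.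
  by rewrite ge0_integral_pushforward//; exact: measurable_oppr.
by apply: eq_measure_integral => A mA _; exact: lebesgue_measureN.
Qed.

(** Squaring [expR (y / 2) <= (1 - y / 2)^-1] leaves a polynomial inequality, whose difference of
    sides factors explicitly. *)
Lemma expR_le_quad (y : R) : y <= 1 -> expR y <= 1 + y + 2 * y ^+ 2.
Proof.
move=> y1; have y2 : 0 < 1 - y / 2 by lra.
have e1 : expR (y / 2) <= (1 - y / 2)^-1.
  rewrite -[y / 2]opprK expRN lef_pV2 ?posrE ?expR_gt0 ?opprK//.
  by have := expR_ge1Dx (- (y / 2)); lra.
have -> : expR y = expR (y / 2) ^+ 2.
  by rewrite expr2 -expRD; congr expR; field.
apply: (@le_trans _ _ ((1 - y / 2)^-1 ^+ 2)).
  by rewrite ler_pXn2r// ?nnegrE ?expR_ge0// invr_ge0 ltW.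
rewrite exprVn -[leLHS]mul1r ler_pdivrMr ?exprn_gt0//.
rewrite -subr_ge0.
have -> : (1 + y + 2 * y ^+ 2) * (1 - y / 2) ^+ 2 - 1 =
   y ^+ 2 * ((1 - y) * (5 / 4 - y / 2)) by field.
by rewrite mulr_ge0 ?sqr_ge0// mulr_ge0; lra.
Qed.

Section OneVariable.
Context d (T : measurableType d) (P : probability T R).

Lemma ge0_integral_density (X : T -> R) (f : R -> R) (phi : R -> \bar R) :
  measurable_fun setT X -> has_density P X f ->
  measurable_fun setT f -> (forall x, 0 <= f x) ->
  measurable_fun setT phi -> (forall x, (0 <= phi x)%E) ->
  (\int[P]_w phi (X w) = \int[mu]_x (phi x * (f x)%:E))%E.
Proof.
move=> mX Xf mf f0 mphi phi0.
have := @ge0_integral_transfer R _ R _ T _ (measurableTypeR R) P mu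
  X id (cst 1) f mX (@measurable_id _ _ _) (@measurable_cst _ _ _ _ _ _) mf
  (fun=> ler01) f0 _ phi mphi phi0.
move=> <-; first by apply: eq_integral => w _; rewrite mule1.
move=> B mB.
have mXB : measurable (X @^-1` B) by rewrite -[X in measurable X]setTI; exact: mX.
transitivity (\int[P]_(x in X @^-1` B) cst 1%E x)%E; first by [].
by rewrite integral_cst// mul1e; exact: Xf.
Qed.

Lemma bounded_integrable (V : T -> R) (B : R) : measurable_fun setT V ->
  (forall w, `|V w| <= B) -> P.-integrable setT (EFin \o V).
Proof.
move=> mV VB; apply: measurable_bounded_integrable => //.
  by rewrite ltey_eq fin_num_measure.
exists B; split; first exact: num_real.
by move=> C BC w _; exact: le_trans (VB w) (ltW BC).
Qed.

(** Bernstein's argument: as [u * (V w - m) <= 1], the exponential lies below a quadratic whose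
    linear term has mean zero, and one plus twice the variance of [u * V] lies below the claimed
    exponential. *)
Lemma bounded_centred_mgf (V : T -> R) (B s u : R) : measurable_fun setT V ->
  (forall w, `|V w| <= B) -> `|u| * (2 * B) <= 1 ->
  (\int[P]_w ((V w) ^+ 2)%:E <= s%:E)%E ->
  (\int[P]_w (expR (u * (V w - (\int[P]_w V w)%R)))%:E <=
   (expR (2 * u ^+ 2 * s))%:E)%E.
Proof.
move=> mV VB uB EV2; set m := (\int[P]_w V w)%R.
have iV := bounded_integrable mV VB.
have iV2 : P.-integrable setT (EFin \o (fun w => V w ^+ 2)).
  apply: (@bounded_integrable _ (B ^+ 2)); first exact: measurable_funX.
  by move=> w; rewrite normrX ler_pXn2r// nnegrE// (le_trans _ (VB w)).
have ic r : P.-integrable setT (EFin \o (fun=> r)).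
  exact: (@bounded_integrable _ `|r|).
have mB : `|m| <= B.
  rewrite (le_trans (le_normr_Rintegral _ _))//.
  rewrite -[leRHS]mulr1 -[X in _ * X](_ : fine (P setT) = 1); last first.
    by rewrite probability_setT.
  rewrite -Rintegral_cst//; apply: le_Rintegral => //.
  exact: integrable_norm.
(* Coefficients of [1 + y + 2 * y ^+ 2] at [y = u * (V w - m)], expanded in powers of [V w]. *)
pose a0 := 1 - u * m + 2 * u ^+ 2 * m ^+ 2; pose a1 := u - 4 * u ^+ 2 * m.
pose a2 := 2 * u ^+ 2.
have q2 : \int[P]_w (V w ^+ 2) <= s.
  rewrite -lee_fin (le_trans _ EV2)// /Rintegral fineK//.
  by apply: integrable_fin_num.
have iq : P.-integrable setT (EFin \o (fun w => a0 + (a1 * V w + a2 * V w ^+ 2))).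
  have -> : EFin \o (fun w => a0 + (a1 * V w + a2 * V w ^+ 2)) =
     ((EFin \o fun=> a0) \+ ((fun w => a1%:E * (EFin \o V) w) \+
         (fun w => a2%:E * (EFin \o (fun w => V w ^+ 2)%R) w)))%E.
    by apply/funext => w.
  apply: integrableD => //; apply: integrableD => //; exact: integrableZl.
apply: (@le_trans _ _ (\int[P]_w (a0 + (a1 * V w + a2 * V w ^+ 2))%R%:E)%E).
  apply: ge0_le_integral => //.
  - apply/measurable_EFinP/measurableT_comp => //.
    by apply: measurable_funM => //; exact: measurable_funB.
  - exact: measurable_int iq.
  move=> w _; rewrite lee_fin.
  have le1 : u * (V w - m) <= 1.
    apply: le_trans (ler_norm _) _; rewrite normrM (le_trans _ uB)//.
    rewrite ler_wpM2l// (le_trans (ler_normB _ _))//.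
    by have := VB w; lra.
  apply: le_trans (expR_le_quad le1) _; rewrite /a0 /a1 /a2.
  by rewrite le_eqVlt; apply/orP; left; apply/eqP; ring.
have -> : (\int[P]_w (a0 + (a1 * V w + a2 * V w ^+ 2))%R%:E)%E =
   (a0 + (a1 * m + a2 * \int[P]_w (V w ^+ 2)))%:E.
  rewrite -(fineK (integrable_fin_num measurableT iq))//; congr EFin.
  rewrite -/(Rintegral _ _ _).
  have iz1 : P.-integrable setT (EFin \o (fun w => a1 * V w)).
    exact: integrableZl iV.
  have iz2 : P.-integrable setT (EFin \o (fun w => a2 * V w ^+ 2)).
    exact: integrableZl iV2.
  have iz12 : P.-integrable setT
      (EFin \o (fun w => a1 * V w + a2 * V w ^+ 2)).
    by have := integrableD measurableT iz1 iz2.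
  have Rc r : \int[P]_w r = r.
    rewrite Rintegral_cst// -[RHS]mulr1; congr (_ * _).
    by rewrite -[RHS]/(fine 1%E) -(probability_setT P).
  rewrite (RintegralD measurableT (ic a0) iz12) (RintegralD measurableT iz1 iz2).
  by rewrite Rc !RintegralZl.
rewrite lee_fin; apply: le_trans (expR_ge1Dx _).
have -> : a0 + (a1 * m + a2 * \int[P]_w V w ^+ 2) =
  1 + 2 * u ^+ 2 * (\int[P]_w V w ^+ 2) - 2 * (u * m) ^+ 2.
  by rewrite /a0 /a1 /a2; ring.
have : 2 * u ^+ 2 * (\int[P]_w V w ^+ 2) <= 2 * u ^+ 2 * s.
  by rewrite ler_wpM2l// mulr_ge0// sqr_ge0.
by have := sqr_ge0 (u * m); lra.
Qed.

End OneVariable.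
End Laws.

(** * Moment generating functions of the two noises *)

Section NoiseMgf.
Context {R : realType} d (T : measurableType d) (P : probability T R).
Notation mu := (@lebesgue_measure R).

Let mexp (u : R) : measurable_fun setT (fun x : R => (expR (u * x))%:E).
Proof. by apply/measurable_EFinP/measurableT_comp => //; exact: measurable_funM. Qed.

(** On each half-line the tilted density is a multiple of an exponential density, of rate [1 - u] on
    the right and [1 + u] on the left. The masses add up to [(1 - u ^+ 2)^-1], at most
    [1 + 2 * u ^+ 2] in the given range. *)
Lemma laplace_mgf (X : T -> R) (u : R) : measurable_fun setT X ->
  has_density P X (fun x => expR (- `|x|) / 2) -> u ^+ 2 <= 1 / 2 ->
  (\int[P]_w (expR (u * X w))%:E <= (expR (2 * u ^+ 2))%:E)%E.
Proof.
move=> mX Xd u2.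
have u1 : `|u| < 1.
  rewrite -(@ltr_pXn2r _ 2)// ?nnegrE// expr1n real_normK ?num_real//; lra.
have := u1; rewrite ltr_norml => /andP[uN1 uP1].
have r1 : 0 < 1 - u by lra.
have r2 : 0 < 1 + u by lra.
rewrite (@ge0_integral_density _ _ _ P X (fun x => expR (- `|x|) / 2)
  (fun x => (expR (u * x))%:E))//; last first.
- by apply: measurable_funM => //; apply: measurableT_comp => //;
    apply: measurableT_comp => //; exact: measurableT_comp.
pose g1 (x : R) := ((2 * (1 - u))^-1 * exponential_pdf (1 - u) x)%:E.
pose g2 (x : R) := ((2 * (1 + u))^-1 * exponential_pdf (1 + u) x)%:E.
have mg1 : measurable_fun setT g1.
  apply/measurable_EFinP/measurable_funM => //.
  exact: measurable_exponential_pdf.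
have mg2 : measurable_fun setT g2.
  apply/measurable_EFinP/measurable_funM => //.
  exact: measurable_exponential_pdf.
have g10 x : (0 <= g1 x)%E.
  rewrite lee_fin mulr_ge0 ?invr_ge0 ?exponential_pdf_ge0 ?mulr_ge0//; lra.
have g20 x : (0 <= g2 x)%E.
  rewrite lee_fin mulr_ge0 ?invr_ge0 ?exponential_pdf_ge0 ?mulr_ge0//; lra.
apply: (@le_trans _ _ (\int[mu]_x (g1 x + g2 (- x)%R))%E).
  apply: ge0_le_integral_nomeas => x.
    by rewrite -EFinM lee_fin !mulr_ge0.
  rewrite -EFinM; have [x0|x0] := leP 0 x.
    apply: (@le_trans _ _ (g1 x)); last by rewrite leeDl.
    rewrite lee_fin exponential_pdfE// ger0_norm// mulrA -expRD invfM.
    rewrite -mulrA mulKf ?gt_eqF// mulrC ler_pM2l// ler_expR; lra.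
  apply: (@le_trans _ _ (g2 (- x))%R); last by rewrite leeDr.
  rewrite lee_fin exponential_pdfE; last by lra.
  rewrite ltr0_norm// mulrA -expRD invfM.
  rewrite -mulrA mulKf ?gt_eqF// mulrC ler_pM2l// ler_expR; lra.
rewrite ge0_integralD//; last first.
  by apply: measurableT_comp => //; exact: measurable_oppr.
rewrite (ge0_integral_lebesgueN mg2 g20).
have gi (r : R) : 0 < r -> (\int[mu]_x ((2 * r)^-1 * exponential_pdf r x)%:E =
    ((2 * r)^-1)%:E)%E.
  move=> r0; under eq_integral do rewrite EFinM.
  rewrite ge0_integralZl//; last 3 first.
  - by apply/measurable_EFinP; exact: measurable_exponential_pdf.
  - by move=> x _; rewrite lee_fin exponential_pdf_ge0// ltW.
  - by rewrite lee_fin invr_ge0 mulr_ge0// ltW.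
  by rewrite integral_exponential_pdf// mule1.
rewrite !gi// -EFinD lee_fin.
apply: le_trans (expR_ge1Dx _).
have -> : (2 * (1 - u))^-1 + (2 * (1 + u))^-1 = (1 - u ^+ 2)^-1.
  have : 1 - u ^+ 2 != 0 by rewrite gt_eqF//; lra.
  by move=> ?; field; rewrite ?andbT !gt_eqF//=; lra.
have u20 : 0 < 1 - u ^+ 2 by lra.
rewrite -[leLHS]mul1r ler_pdivrMr//.
have := sqr_ge0 u; set y := u ^+ 2; move: u2; rewrite -/y => y2 y0.
by nra.
Qed.

(** Completing the square turns the tilted density into a normal density of mean [u * s2]; the exact
    exponent, half the stated one, is rounded up. Variance zero is a point mass and is treated
    apart. *)
Lemma centred_gaussian_mgf (X : T -> R) (s2 u : R) : measurable_fun setT X ->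
  0 <= s2 ->
  (forall A, measurable A -> P (X @^-1` A) = centred_gaussian s2 A) ->
  (\int[P]_w (expR (u * X w))%:E <= (expR (s2 * u ^+ 2))%:E)%E.
Proof.
move=> mX s20 XA.
have [s0|s0] := eqVneq s2 0.
  have := @ge0_integral_transfer R _ R _ T _ R P (dirac (0 : R)) X id
    (cst 1) (cst 1) mX (@measurable_id _ _ _) (@measurable_cst _ _ _ _ _ _)
    (@measurable_cst _ _ _ _ _ _) (fun=> ler01) (fun=> ler01).
  move=> /(_ _ (fun x => (expR (u * x))%:E) (mexp u)) E.
  have -> : (\int[P]_w (expR (u * X w))%:E =
             \int[P]_w ((expR (u * X w))%:E * (cst 1%R w)%:E))%E.
    by apply: eq_integral => w _; rewrite mule1.
  rewrite E; last 2 first.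
  - move=> B mB; have mXB : measurable (X @^-1` B).
      by rewrite -[X in measurable X]setTI; exact: mX.
    apply: etrans; first exact: (integral_cst _ mXB 1%E).
    apply: etrans; last by apply: esym; exact: (integral_cst _ mB 1%E).
    by rewrite /= XA// /centred_gaussian s0 eqxx.
  - by move=> y; rewrite lee_fin expR_ge0.
  rewrite integral_dirac//; last first.
    by apply: (emeasurable_funM (mexp u)); exact: (measurable_cst 1%E).
  by rewrite diracT mul1e mulr0 expR0 mule1 s0 mul0r expR0.
have sg0 : Num.sqrt s2 != 0 by rewrite gt_eqF// sqrtr_gt0 lt0r s0.
have Xd : has_density P X (normal_pdf 0 (Num.sqrt s2)).
  by move=> A mA; rewrite XA// /centred_gaussian (negbTE s0).
rewrite (@ge0_integral_density _ _ _ P X (normal_pdf 0 (Num.sqrt s2))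
  (fun x => (expR (u * x))%:E))//; last 2 first.
- exact: measurable_normal_pdf.
- by move=> x; exact: normal_pdf_ge0.
have -> : (\int[mu]_x ((expR (u * x))%:E * (normal_pdf 0 (Num.sqrt s2) x)%:E) =
  \int[mu]_x ((expR (s2 * u ^+ 2 / 2))%:E *
     (normal_pdf (u * s2) (Num.sqrt s2) x)%:E))%E.
  apply: eq_integral => x _; rewrite -!EFinM !normal_pdfE// /normal_fun; congr EFin.
  rewrite mulrCA [RHS]mulrCA -!expRD; congr (_ * expR _).
  by rewrite sqr_sqrtr//; field.
rewrite ge0_integralZl//; last 2 first.
- by apply/measurable_EFinP; exact: measurable_normal_pdf.
- by move=> x _; rewrite lee_fin normal_pdf_ge0.
rewrite integral_normal_pdf mule1 lee_fin ler_expR.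
by have := mulr_ge0 s20 (sqr_ge0 u); lra.
Qed.

End NoiseMgf.

Section NoisySums.
Context {R : realType} d (T : measurableType d) (P : probability T R).
Notation mu := (@lebesgue_measure R).

Lemma integrable_bounded_density (g f : R -> R) (B : R) :
  measurable_fun setT g -> (forall x, `|g x| <= B) -> is_density f ->
  mu.-integrable setT (EFin \o (fun x => g x * f x)).
Proof.
move=> mg gB [mf f0 f1].
have iBf : mu.-integrable setT (fun x => B%:E * (f x)%:E)%E.
  apply: integrableZl => //; apply/integrableP; split.
    exact/measurable_EFinP.
  under eq_integral do rewrite /= ger0_norm//.
  by rewrite f1 ltry.
apply: (le_integrable measurableT _ _ iBf).
- by apply/measurable_EFinP; exact: measurable_funM.
- move=> x _ /=; rewrite lee_fin !normrM (ger0_norm (f0 x)) ler_wpM2r//.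
  by apply: le_trans (gB x) _; exact: ler_norm.
Qed.

(** Adding [B] makes the integrand nonnegative, so that the transfer applies; both sides grow by the
    same [B], since [P] and [f] have total mass 1. *)
Lemma Rintegral_density (X : T -> R) (g f : R -> R) (B : R) :
  measurable_fun setT X -> has_density P X f -> is_density f ->
  measurable_fun setT g -> (forall x, `|g x| <= B) ->
  \int[P]_w g (X w) = \int[mu]_x (g x * f x).
Proof.
move=> mX Xf df mg gB; have [mf f0 f1] := df.
have B0 x : 0 <= g x + B.
  by have := gB x; rewrite ler_norml => /andP[]; lra.
have mgB : measurable_fun setT (fun x => (g x + B)%:E).
  by apply/measurable_EFinP; exact: measurable_funD.
have gB0 x : (0 <= (g x + B)%:E)%E by rewrite lee_fin.
have := ge0_integral_density mX Xf mf f0 mgB gB0.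
have iX : P.-integrable setT (EFin \o (fun w => g (X w))).
  by apply: (@bounded_integrable _ _ _ _ _ B) => //; exact: measurableT_comp.
have ic : P.-integrable setT (EFin \o (fun=> B)).
  exact: (@bounded_integrable _ _ _ _ _ `|B|).
have igf := integrable_bounded_density mg gB df.
have if_ : mu.-integrable setT (EFin \o (fun x => 1 * f x)).
  by apply: (@integrable_bounded_density _ _ 1) => // x; rewrite normr1.
have iBf : mu.-integrable setT (EFin \o (fun x => B * f x)).
  by apply: (@integrable_bounded_density _ _ `|B|) => // x.
have -> : (\int[P]_w (g (X w) + B)%:E)%E = (\int[P]_w g (X w) + B)%:E.
  have iD : P.-integrable setT (EFin \o (fun w => g (X w) + B)).
    by have := integrableD measurableT iX ic.
  rewrite -(fineK (integrable_fin_num measurableT iD))//; congr EFin.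
  rewrite -/(Rintegral _ _ _) (RintegralD measurableT iX ic); congr (_ + _).
  rewrite Rintegral_cst// -[RHS]mulr1; congr (_ * _).
  by rewrite -[RHS]/(fine 1%E) -(probability_setT P).
have -> : (\int[mu]_x ((g x + B)%:E * (f x)%:E))%E =
    (\int[mu]_x (g x * f x) + B)%:E.
  have -> : (\int[mu]_x ((g x + B)%:E * (f x)%:E))%E =
            (\int[mu]_x (g x * f x + B * f x)%:E)%E.
    by apply: eq_integral => x _; rewrite -EFinM mulrDl.
  have iD : mu.-integrable setT (EFin \o (fun x => g x * f x + B * f x)).
    by have := integrableD measurableT igf iBf.
  rewrite -(fineK (integrable_fin_num measurableT iD))//; congr EFin.
  rewrite -/(Rintegral _ _ _) (RintegralD measurableT igf iBf); congr (_ + _).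
  have -> : \int[mu]_x (B * f x) = \int[mu]_x (B * (1 * f x)).
    by apply: eq_Rintegral => x _; rewrite mul1r.
  rewrite RintegralZl// -[RHS]mulr1; congr (_ * _).
  rewrite -[RHS]/(fine 1%E) -f1; congr fine; apply: eq_integral => x _.
  by rewrite mul1r.
by move=> [] /addIr.
Qed.

Definition observable n (X : 'I_n -> T -> R) (W : 'I_n -> R -> T -> R)
    (k : 'I_n + 'I_n * R) : T -> R :=
  match k with inl i => X i | inr ih => W ih.1 ih.2 end.

(* What the Laplace and the Gaussian mechanism have in common: the noise is
   W i h, rescaled by c / h, and it is sub-exponential. *)
Record noise_model (A : R) n (Hn : set R) (f : R -> R) (X : 'I_n -> T -> R)
    (W : 'I_n -> R -> T -> R) : Prop := NoiseModel {
  noise_mX : forall i, measurable_fun setT (X i);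
  noise_mW : forall i h, measurable_fun setT (W i h);
  noise_density : forall i, has_density P (X i) f;
  noise_indep : indep_systems P
    [set k : 'I_n + 'I_n * R | if k is inr ih then Hn ih.2 else True]
    (fun k => g_sigma_algebra_preimage (observable X W k));
  noise_mgf : forall i h u, Hn h -> `|u| <= 1 ->
    (\int[P]_w (expR (u * W i h w))%:E <= (expR (A * u ^+ 2))%:E)%E }.

(** By independence the expectation splits into one factor per [X i] and one per noise variable. A
    signal factor is controlled by the second moment of [g (X i)], which is at most [M * s] because
    f is at most M. *)
Lemma noisy_sum_mgf (A M B s u : R) n (Hn : set R) (f g : R -> R)
    (X : 'I_n -> T -> R) (W : 'I_n -> R -> T -> R) (hs : seq R) (b : R -> R) :
  noise_model A Hn f X W -> 2 <= A -> is_density f -> (forall x, f x <= M) ->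
  uniq hs -> {in hs, forall h, Hn h} ->
  measurable_fun setT g -> (forall x, `|g x| <= B) ->
  (\int[mu]_x ((g x) ^+ 2)%:E <= s%:E)%E ->
  `|u| * (2 * B) <= 1 -> {in hs, forall h, `|u * b h| <= 1} ->
  (\int[P]_w (expR (u * \sum_(i < n) (g (X i w) - \int[mu]_x (g x * f x) +
      \sum_(h <- hs) b h * W i h w)))%:E <=
   (expR (n%:R * (A * u ^+ 2 * (M * s + \sum_(h <- hs) b h ^+ 2))))%:E)%E.
Proof.
move=> model A2 df fM uhs hsH mg gB gs uB ub.
set m := \int[mu]_x (g x * f x).
have [mf f0 f1] := df.
have M0 : 0 <= M by exact: le_trans (f0 0) (fM 0).
have s0 : 0 <= s.
  by rewrite -lee_fin (le_trans _ gs)// integral_ge0// => x _; rewrite lee_fin sqr_ge0.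
pose S : seq ('I_n + 'I_n * R) :=
  [seq inl i | i <- index_enum 'I_n] ++
  [seq inr ih | ih <- [seq (i, h) | i <- index_enum 'I_n, h <- hs]].
pose phi (k : 'I_n + 'I_n * R) (x : R) : R :=
  match k with inl _ => expR (u * (g x - m)) | inr ih => expR (u * b ih.2 * x) end.
pose cc (k : 'I_n + 'I_n * R) : R :=
  match k with inl _ => A * u ^+ 2 * (M * s)
             | inr ih => A * u ^+ 2 * b ih.2 ^+ 2 end.
pose Y := observable X W.
have mY k : measurable_fun setT (Y k).
  by case: k => [i|ih]; [exact: noise_mX model _|exact: noise_mW model _ _].
have mphi k : measurable_fun setT (phi k).
  case: k => [i|ih]; apply: measurableT_comp => //.
    by apply: measurable_funM => //; exact: measurable_funB.
have phi0 k x : 0 <= phi k x by case: k => *; exact: expR_ge0.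
have inS k : k \in S -> if k is inr ih then ih.2 \in hs else true.
  case: k => [//|[i h]]; rewrite mem_cat => /orP[/mapP[]//|].
  by move=> /mapP[_ /allpairsP[[j h'] /= [_ h'hs ->]] [_ ->]].
have le_c k : k \in S ->
    (\int[P]_w (phi k (Y k w))%:E <= (expR (cc k))%:E)%E.
  move=> /inS; case: k => [i _|[i h] /= hhs].
    have mV : measurable_fun setT (fun w => g (X i w)).
      by apply: measurableT_comp => //; exact: noise_mX model _.
    have EV2 : (\int[P]_w ((g (X i w)) ^+ 2)%:E <= (M * s)%:E)%E.
      have -> : (\int[P]_w ((g (X i w)) ^+ 2)%:E =
                 \int[mu]_x ((g x ^+ 2)%:E * (f x)%:E))%E.
        apply: (ge0_integral_density (noise_mX model i)
          (noise_density model i) mf f0 (phi := fun x => (g x ^+ 2)%:E)).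
          by apply/measurable_EFinP; exact: measurable_funX.
        by move=> x; rewrite lee_fin sqr_ge0.
      apply: (@le_trans _ _ (\int[mu]_x (M%:E * (g x ^+ 2)%:E))%E).
        apply: ge0_le_integral_nomeas => x.
          by rewrite -EFinM lee_fin mulr_ge0// sqr_ge0.
        by rewrite muleC -!EFinM lee_fin ler_wpM2r// sqr_ge0.
      rewrite ge0_integralZl//.
      - by rewrite EFinM lee_wpmul2l.
      - by apply/measurable_EFinP; exact: measurable_funX.
      - by move=> x _; rewrite lee_fin sqr_ge0.
    have gXB w : `|g (X i w)| <= B by [].
    have := bounded_centred_mgf mV gXB uB EV2.
    rewrite (Rintegral_density (noise_mX model i) (noise_density model i) df mg gB).
    rewrite -/m => /le_trans; apply; rewrite lee_fin ler_expR ler_wpM2r//.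
      exact: mulr_ge0.
    by rewrite ler_wpM2r// sqr_ge0.
  have := noise_mgf model i (hsH _ hhs) (ub _ hhs).
  by rewrite exprMn mulrA.
pose e k := fine (\int[P]_w (phi k (Y k w))%:E)%E.
have eE k : k \in S -> (\int[P]_w (phi k (Y k w))%:E = (e k)%:E)%E.
  move=> kS; rewrite fineK// ge0_fin_numE.
    exact: le_lt_trans (le_c _ kS) (ltry _).
  by rewrite integral_ge0// => w _; rewrite lee_fin.
have uS : uniq S.
  rewrite cat_uniq; apply/and3P; split.
  - by rewrite map_inj_uniq ?index_enum_uniq// => i j [].
  - apply/hasPn => k /mapP[ih _ ->]; apply/mapP => -[] //.
  rewrite map_inj_uniq => [|ih jh []//].
  by apply: allpairs_uniq => //; rewrite ?index_enum_uniq// => -[? ?] [? ?].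
have SD k : k \in S ->
    [set k : 'I_n + 'I_n * R | if k is inr ih then Hn ih.2 else True] k.
  by move=> /inS; case: k => //= ih; exact: hsH.
have := indep_ge0_integral_prod mY (noise_indep model) mphi phi0 uS SD eE.
have -> : (\int[P]_w (\prod_(k <- S) phi k (Y k w))%:E)%E =
  (\int[P]_w (expR (u * \sum_(i < n) (g (X i w) - m +
      \sum_(h <- hs) b h * W i h w)))%:E)%E.
  apply: eq_integral => w _; congr EFin.
  rewrite big_cat /= !big_map big_allpairs /=.
  under [X in _ * X]eq_bigr do rewrite -expR_sum.
  rewrite -!expR_sum -expRD -big_split; congr expR.
  apply: esym; apply: etrans; first exact: mulr_sumr.
  apply: eq_bigr => i _; rewrite mulrDr; congr (_ + _).
  apply: etrans; first exact: mulr_sumr.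
  by apply: eq_bigr => h _; rewrite mulrA.
move=> ->; rewrite lee_fin.
apply: (@le_trans _ _ (\prod_(k <- S) expR (cc k))).
  rewrite big_seq [leRHS]big_seq; apply: ler_prod => k kS.
  rewrite -!lee_fin -eE// le_c// andbT integral_ge0// => w _.
  by rewrite lee_fin.
rewrite -expR_sum ler_expR le_eqVlt; apply/orP; left; apply/eqP.
rewrite big_cat /= !big_map big_allpairs /=.
rewrite !sumr_const card_ord !mulrDr !mulr_natl; congr (_ + _ *+ _).
by apply: esym; exact: mulr_sumr.
Qed.

End NoisySums.

Section Mechanisms.
Context {R : realType} d (T : measurableType d) (P : probability T R).

Lemma indep_systemsS (I : choiceType) (D : set I) (G G' : I -> set (set T)) :
  (forall k, G' k `<=` G k) -> indep_systems P D G -> indep_systems P D G'.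
Proof. by move=> GG' indG J A JD AG; apply: indG => // k kJ; exact/GG'/AG. Qed.

(** In the Laplace case, division by [Num.sqrt 2] absorbs the factor in the observation and keeps
    the argument in the range of [laplace_mgf]. In the Gaussian case only the value of the process
    at t enters, a centred normal of variance [K 0] whatever h is. The entry 2 of the maximum covers
    the Laplace noise and the condition [2 <= A] of the sum bound. *)
Lemma private_observations_noise_model (m : mechanism) (K : R -> R)
    (Delta alpha beta c t : R) n (Hn : set R) (f : R -> R)
    (X : 'I_n -> {RV P >-> R}) (Z : 'I_n -> R -> T -> R) :
  admissible m K Delta alpha beta -> iid_sample f X ->
  private_observations m Hn K c t X Z ->
  exists2 W : 'I_n -> R -> T -> R,
    noise_model P (Num.max 2 (K 0)) Hn f (fun i => X i : T -> R) W &
    forall i h w, Hn h -> Z i h w = Kh K h (X i w - t) + c / h * W i h w.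
Proof.
case: m => /= adm [Xf _].
  move=> [xi [xid indxi ZE]]; exists (fun i h w => xi i h w / Num.sqrt 2).
    split=> //.
    - by move=> i h; apply: measurable_funM.
    - apply: indep_systemsS indxi => -[i|[i h]] //= A.
      rewrite /g_sigma_algebra_preimage /preimage_set_system /= => -[B mB <-].
      exists ((fun x : R => x / Num.sqrt 2) @^-1` B) => //.
      rewrite -[X in measurable X]setTI.
      by apply: measurable_funM => //; exact: measurable_id.
    - move=> i h u Hh u1.
      have u2 : u ^+ 2 <= 1.
        by rewrite -[u ^+ 2]real_normK ?num_real// expr_le1.
      have uE : (u / Num.sqrt 2) ^+ 2 = u ^+ 2 / 2.
        by rewrite exprMn exprVn sqr_sqrtr.
      have mxi : measurable_fun setT (xi i h) by [].
      have := laplace_mgf (u := u / Num.sqrt 2) mxi (xid i h Hh).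
      have -> : (\int[P]_w (expR (u / Num.sqrt 2 * xi i h w))%:E =
                 \int[P]_w (expR (u * (xi i h w / Num.sqrt 2)))%:E)%E.
        by apply: eq_integral => w _; rewrite mulrAC mulrA.
      rewrite uE => le_exp; apply: le_trans (le_exp _) _; first by lra.
      rewrite lee_fin ler_expR mulrCA mulfV// mulr1.
      have : 2 <= Num.max 2 (K 0) by rewrite le_max lexx.
      by have := sqr_ge0 u; nra.
  move=> i h w Hh; rewrite ZE// invfM; congr (_ + _); ring.
move=> [Xi [Xig indXi ZE]]; exists (fun i h => Xi i h t : T -> R) => //.
have K0 : 0 <= K 0.
  case: adm => _ _ _ [_ /(_ 1%N (fun=> 0) (fun=> 1))] + _.
  by rewrite !big_ord1 subrr !mul1r.
split=> //.
- apply: indep_systemsS indXi => -[i|[i h]] //= A mA.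
  by apply: sub_gen_smallest; exists t.
- move=> i h u Hh u1.
  have law A : measurable A ->
      P ((Xi i h t : T -> R) @^-1` A) = centred_gaussian (K 0) A.
    move=> mA; have := Xig i h Hh 1%N (fun=> t) (fun=> 1) A mA.
    rewrite !big_ord1 !mul1r /scaled_kernel subrr mul0r => <-.
    by congr (P _); apply/funext => w /=; rewrite big_ord1 mul1r.
  have mXi : measurable_fun setT (Xi i h t) by [].
  have := centred_gaussian_mgf u mXi K0 law.
  move=> /le_trans; apply; rewrite lee_fin ler_expR ler_wpM2r ?sqr_ge0//.
  by rewrite le_max lexx orbT.
Qed.

End Mechanisms.

(** * Kernels in L2 *)

Section KernelNorms.
Context {R : realType} (K : R -> R) (hK : is_kernel K).
Notation mu := (@lebesgue_measure R).

Lemma L2sq_ge0 : 0 <= L2sq K.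
Proof. by apply: Rintegral_ge0 => u _; exact: sqr_ge0. Qed.

Lemma integral_kernel_sqr : (\int[mu]_u (K u ^+ 2)%:E = (L2sq K)%:E)%E.
Proof.
rewrite /L2sq /Rintegral fineK//.
exact: integrable_fin_num (kernel_square_integrable hK).
Qed.

(* A kernel with zero L2 norm vanishes almost everywhere, so that it cannot
   integrate to 1, even in the improper sense. *)
Lemma L2sq_gt0 : 0 < L2sq K.
Proof.
rewrite lt0r L2sq_ge0 andbT; apply/eqP => L0.
have mK := kernel_measurable hK.
have K0 : ae_eq mu setT (fun u => (K u ^+ 2)%:E) (cst 0%E).
  apply/ae_eq_integral_abs => //.
    exact: measurable_int (kernel_square_integrable hK).
  under eq_integral do rewrite gee0_abs ?lee_fin ?sqr_ge0//.
  by rewrite integral_kernel_sqr L0.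
have I0 (p : R * R) : \int[mu]_(u in `[p.1, p.2]) K u = 0.
  rewrite /Rintegral (@ae_eq_integral _ _ _ mu _ (cst 0%E))//.
  - by rewrite integral0.
  - by apply/measurable_EFinP; exact: measurable_funTS.
  - apply: filterS K0 => u /= + _ => /(_ I)[] /eqP.
    by rewrite sqrf_eq0 => /eqP ->.
have := kernel_integral1 hK.
rewrite (_ : (fun p : R * R => _) = cst 0); last by apply/funext => p; exact: I0.
move=> c1.
have c0 : cst (0 : R) @ filter_prod (ninfty_nbhs R) (pinfty_nbhs R) --> (0 : R).
  exact: cvg_cst.
have /eqP : (0 : R) = 1 by apply: cvg_unique c0 c1; exact: norm_hausdorff.
by rewrite eq_sym oner_eq0.
Qed.

Lemma measurable_Kh (h : R) : measurable_fun setT (Kh K h).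
Proof.
apply: measurable_funM => //; apply: measurableT_comp; first exact: kernel_measurable hK.
exact: measurable_funM.
Qed.

Lemma integral_Kh_sqr (h t : R) : 0 < h ->
  (\int[mu]_x (Kh K h (x - t) ^+ 2)%:E = (L2sq K / h)%:E)%E.
Proof.
move=> h0.
pose phi (u : R) := ((h^-1 * K u) ^+ 2)%:E.
have -> : (\int[mu]_x (Kh K h (x - t) ^+ 2)%:E =
           \int[mu]_x phi ((x - t) / h)%R)%E by [].
have mphi : measurable_fun setT phi.
  apply/measurable_EFinP/measurable_funX/measurable_funM => //.
  exact: kernel_measurable hK.
rewrite ge0_integral_lebesgue_affine//; last by move=> x; rewrite lee_fin sqr_ge0.
have -> : (\int[mu]_x phi x)%E = (h^-1 ^+ 2 * L2sq K)%:E.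
  rewrite /phi; under eq_integral do rewrite exprMn EFinM.
  rewrite ge0_integralZl//.
  - by rewrite integral_kernel_sqr.
  - exact: measurable_int (kernel_square_integrable hK).
  - by move=> x _; rewrite lee_fin sqr_ge0.
  - by rewrite lee_fin sqr_ge0.
rewrite -EFinM; congr EFin; field; by rewrite gt_eqF.
Qed.

Let integral_Kh_sqr0 (h : R) : 0 < h ->
  (\int[mu]_x (Kh K h x ^+ 2)%:E = (L2sq K / h)%:E)%E.
Proof.
move=> h0; rewrite -(integral_Kh_sqr 0 h0); apply: eq_integral => x _.
by rewrite subr0.
Qed.

Lemma integrable_Kh_sqr (h : R) : 0 < h ->
  mu.-integrable setT (EFin \o (fun u => Kh K h u ^+ 2)).
Proof.
move=> h0; apply/integrableP; split.
  by apply/measurable_EFinP/measurable_funX; exact: measurable_Kh.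
under eq_integral do rewrite /= ger0_norm ?sqr_ge0//.
by rewrite integral_Kh_sqr0// ltry.
Qed.

Lemma Rintegral_Kh_sqr (h : R) : 0 < h -> \int[mu]_u (Kh K h u ^+ 2) = L2sq K / h.
Proof.
move=> h0; by rewrite /Rintegral integral_Kh_sqr0.
Qed.

Definition L2dist (h eta : R) : R := \int[mu]_u ((Kh K h u - Kh K eta u) ^+ 2).

Let mdist (h eta : R) :
  measurable_fun setT (fun u => (Kh K h u - Kh K eta u) ^+ 2).
Proof. by apply: measurable_funX; apply: measurable_funB; exact: measurable_Kh. Qed.

Lemma integrable_Kh_dist (h eta : R) : 0 < h -> 0 < eta ->
  mu.-integrable setT (EFin \o (fun u => (Kh K h u - Kh K eta u) ^+ 2)).
Proof.
move=> h0 eta0.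
have := integrableD measurableT (integrableZl measurableT 2 (integrable_Kh_sqr h0))
  (integrableZl measurableT 2 (integrable_Kh_sqr eta0)).
apply: le_integrable => //.
  by apply/measurable_EFinP; exact: mdist.
move=> u _ /=; rewrite lee_fin ger0_norm ?sqr_ge0// ger0_norm.
  by have := sqr_ge0 (Kh K h u + Kh K eta u); rewrite !expr2; nra.
by rewrite addr_ge0// mulr_ge0// sqr_ge0.
Qed.

Lemma integral_Kh_dist (h eta t : R) : 0 < h -> 0 < eta ->
  (\int[mu]_x ((Kh K h (x - t) - Kh K eta (x - t)) ^+ 2)%:E =
   (L2dist h eta)%:E)%E.
Proof.
move=> h0 eta0.
pose phi (u : R) := ((Kh K h u - Kh K eta u) ^+ 2)%:E.
transitivity (\int[mu]_x phi ((x - t) / 1)%R)%E.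
  by apply: eq_integral => x _; rewrite divr1.
rewrite ge0_integral_lebesgue_affine//; last 2 first.
- by apply/measurable_EFinP; exact: mdist.
- by move=> x; rewrite lee_fin sqr_ge0.
rewrite mul1e /L2dist /Rintegral fineK//.
exact: integrable_fin_num (integrable_Kh_dist h0 eta0).
Qed.

Lemma L2dist_ge0 (h eta : R) : 0 <= L2dist h eta.
Proof. by apply: Rintegral_ge0 => u _; exact: sqr_ge0. Qed.

Lemma L2dist_le (h eta : R) : 0 < h -> 0 < eta ->
  L2dist h eta <= 2 * (L2sq K / h) + 2 * (L2sq K / eta).
Proof.
move=> h0 eta0; rewrite -!Rintegral_Kh_sqr//.
have i1 := integrableZl measurableT 2 (integrable_Kh_sqr h0).
have i2 := integrableZl measurableT 2 (integrable_Kh_sqr eta0).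
rewrite -RintegralZl//; last exact: integrable_Kh_sqr.
rewrite -RintegralZl//; last exact: integrable_Kh_sqr.
rewrite -(RintegralD measurableT i1 i2); apply: le_Rintegral => //.
- exact: integrable_Kh_dist.
- exact: (integrableD measurableT i1 i2).
- move=> u _; have := sqr_ge0 (Kh K h u + Kh K eta u); rewrite !expr2; nra.
Qed.

Definition sep_const (a : R) : R := (a - 1) ^+ 2 / (2 * a * (a + 1)).

(** A weighted reverse triangle inequality: the squared norm of K_eta is at most 1 + s times the
    distance plus 1 + 1/s times the squared norm of K_h, and the latter is at most 1/a times the
    squared norm of K_eta. *)
Lemma L2dist_ge (a h eta : R) : 1 < a -> 0 < eta -> a * eta <= h ->
  sep_const a * (L2sq K / eta) <= L2dist h eta.
Proof.
move=> a1 eta0 aeta.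
have a0 : 0 < a by lra.
have h0 : 0 < h by apply: lt_le_trans aeta; rewrite mulr_gt0.
have L0 := L2sq_ge0.
(* This makes 1 + 1/s the midpoint of 1 and a, still below the factor a gained from the norms;
   [sep_const] is the constant that results. *)
pose s := 2 / (a - 1).
have s0 : 0 < s by rewrite divr_gt0// subr_gt0.
have i1 := integrableZl measurableT (1 + s) (integrable_Kh_dist h0 eta0).
have i2 := integrableZl measurableT (1 + s^-1) (integrable_Kh_sqr h0).
have : L2sq K / eta <= (1 + s) * L2dist h eta + (1 + s^-1) * (L2sq K / h).
  rewrite -!Rintegral_Kh_sqr// /L2dist.
  rewrite -RintegralZl//; last exact: integrable_Kh_dist.
  rewrite -RintegralZl//; last exact: integrable_Kh_sqr.
  rewrite -(RintegralD measurableT i1 i2); apply: le_Rintegral => //.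
  - exact: integrable_Kh_sqr.
  - exact: (integrableD measurableT i1 i2).
  - move=> u _; rewrite -subr_ge0.
    set x := Kh K h u; set y := Kh K eta u.
    rewrite (_ : _ - _ = s * ((x - y) + x / s) ^+ 2).
      by rewrite mulr_ge0 ?sqr_ge0// ltW.
    field; by rewrite gt_eqF.
have : L2sq K / h <= L2sq K / eta / a.
  rewrite -mulrA ler_wpM2l// -invfM lef_pV2 ?posrE ?mulr_gt0//.
  by rewrite mulrC.
have -> : 1 + s^-1 = (a + 1) / 2 by rewrite /s; field; rewrite gt_eqF// subr_gt0.
have -> : 1 + s = (a + 1) / (a - 1) by rewrite /s; field; rewrite gt_eqF// subr_gt0.
set D := L2dist h eta; set q := L2sq K / eta; set p := L2sq K / h.
move=> pq qD.
have {}qD : q <= (a + 1) / (a - 1) * D + (a + 1) / 2 * (q / a).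
  apply: le_trans qD _; rewrite lerD2l ler_wpM2l//; lra.
have -> : sep_const a * q = (a - 1) / (a + 1) * (q - (a + 1) / 2 * (q / a)).
  by rewrite /sep_const; field; rewrite !gt_eqF//; lra.
have -> : D = (a - 1) / (a + 1) * ((a + 1) / (a - 1) * D).
  by field; rewrite !gt_eqF//; lra.
rewrite ler_wpM2l//; last by lra.
by rewrite divr_ge0; lra.
Qed.

Lemma sep_const_gt0 (a : R) : 1 < a -> 0 < sep_const a.
Proof. by move=> a1; rewrite divr_gt0 ?exprn_gt0 ?mulr_gt0//; lra. Qed.

End KernelNorms.

(** * Deviations of the estimators *)

Section Deviations.
Context {R : realType} d (T : measurableType d) (P : probability T R).
Notation mu := (@lebesgue_measure R).

Lemma sqr_le1_norm (x : R) : x ^+ 2 <= 1 -> `|x| <= 1.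
Proof.
by move=> x1; rewrite -(@expr_le1 _ 2)// real_normK ?num_real.
Qed.

(** Common form for one estimator ([l] = 1) and for a difference of two ([l] a logarithm). The lower
    bounds on [V ^+ 2], by [m0 / (n%:R * eta)] and by the noise variance, keep the argument of every
    factor in the range of its moment bound; the upper bound of the total variance by [V ^+ 2] turns
    the exponent into [A * tau ^+ 2 * l]. *)
Lemma scaled_noisy_sum_mgf (A M B s l tau V m0 eta c : R) n (Hn : set R)
    (f g : R -> R) (X : 'I_n -> T -> R) (W : 'I_n -> R -> T -> R)
    (hs : seq R) (b : R -> R) :
  noise_model P A Hn f X W -> 2 <= A -> is_density f -> (forall x, f x <= M) ->
  uniq hs -> {in hs, forall h, Hn h} ->
  measurable_fun setT g -> (forall x, `|g x| <= 2 * B / eta) ->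
  (\int[mu]_x ((g x) ^+ 2)%:E <= s%:E)%E ->
  {in hs, forall h, b h ^+ 2 <= c ^+ 2 / eta ^+ 2} ->
  (0 < n)%N -> 0 < eta -> 0 < V -> 0 <= l -> l <= n%:R * eta -> l <= n%:R ->
  0 < tau -> tau <= 1 -> 16 * B ^+ 2 * tau ^+ 2 <= m0 ->
  m0 / (n%:R * eta) <= V ^+ 2 -> c ^+ 2 / (n%:R * eta ^+ 2) <= V ^+ 2 ->
  (M * s + \sum_(h <- hs) b h ^+ 2) / n%:R <= V ^+ 2 ->
  forall S : T -> R,
  (forall w, S w = n%:R^-1 * \sum_(i < n) (g (X i w) - \int[mu]_x (g x * f x) +
      \sum_(h <- hs) b h * W i h w)) ->
  (\int[P]_w (expR (tau * Num.sqrt l / V * S w))%:E <= (expR (A * tau ^+ 2 * l))%:E)%E /\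
  (\int[P]_w (expR (- (tau * Num.sqrt l / V * S w)))%:E <=
     (expR (A * tau ^+ 2 * l))%:E)%E.
Proof.
move=> model A2 df fM uhs hsH mg gB gs bc n0 eta0 V0 l0 lneta ln tau0 tau1
  Btau m0V cV sV S SE.
set th := tau * Num.sqrt l / V.
have N0 : 0 < n%:R :> R by rewrite ltr0n.
have th2 : th ^+ 2 = tau ^+ 2 * l / V ^+ 2.
  by rewrite /th !exprMn sqr_sqrtr// exprVn.
have V20 : 0 < V ^+ 2 by rewrite exprn_gt0.
pose u := th / n%:R.
have u2 : u ^+ 2 = tau ^+ 2 * l / (V ^+ 2 * n%:R ^+ 2).
  by rewrite /u exprMn th2; field; rewrite !gt_eqF.
have t2 : 0 <= tau ^+ 2 <= 1 by rewrite sqr_ge0 /= expr_le1// ltW.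
(* The sign e enters the bounds only through its square, so one computation gives both tails. *)
have key (e : R) : e ^+ 2 = 1 ->
  (\int[P]_w (expR (e * (th * S w)))%:E <= (expR (A * tau ^+ 2 * l))%:E)%E.
  move=> e2; have eu2 : (e * u) ^+ 2 = u ^+ 2 by rewrite exprMn e2 mul1r.
  have uB : `|e * u| * (2 * (2 * B / eta)) <= 1.
    apply: (@le_trans _ _ `|e * u * (2 * (2 * B / eta))|).
      by rewrite [leRHS]normrM ler_wpM2l// ler_norm.
    apply: sqr_le1_norm; rewrite exprMn eu2 u2.
    rewrite [leLHS](_ : _ = (16 * B ^+ 2 * tau ^+ 2) * l /
        (V ^+ 2 * n%:R ^+ 2 * eta ^+ 2)).
      rewrite ler_pdivrMr ?mulr_gt0 ?exprn_gt0// mul1r.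
      apply: (@le_trans _ _ (m0 * l)); first by rewrite ler_wpM2r.
      have m0V' : m0 <= V ^+ 2 * (n%:R * eta).
        by rewrite -ler_pdivrMr// mulr_gt0.
      have m00 : 0 <= m0.
        by apply: le_trans Btau; rewrite mulr_ge0 ?sqr_ge0// mulr_ge0 ?sqr_ge0.
      apply: (@le_trans _ _ (V ^+ 2 * (n%:R * eta) * (n%:R * eta))).
        by apply: ler_pM.
      by rewrite le_eqVlt; apply/orP; left; apply/eqP; ring.
    by field; rewrite !gt_eqF.
  have ub : {in hs, forall h, `|e * u * b h| <= 1}.
    move=> h /bc bh; apply: sqr_le1_norm; rewrite exprMn eu2 u2.
    apply: (@le_trans _ _ (tau ^+ 2 * l / (V ^+ 2 * n%:R ^+ 2) * (c ^+ 2 / eta ^+ 2))).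
      by rewrite ler_wpM2l// -u2 sqr_ge0.
    apply: (@le_trans _ _ (tau ^+ 2 * l / (V ^+ 2 * n%:R ^+ 2) * (V ^+ 2 * n%:R))).
      rewrite ler_wpM2l -?u2 ?sqr_ge0//.
      rewrite -ler_pdivrMr// (le_trans _ cV)// le_eqVlt; apply/orP; left.
      by apply/eqP; field; rewrite !gt_eqF.
    rewrite [leLHS](_ : _ = tau ^+ 2 * (l / n%:R)); last by field; rewrite !gt_eqF.
    case/andP: t2 => t20 t21; rewrite mulr_ile1 ?divr_ge0//.
    by rewrite ler_pdivrMr// mul1r.
  have := noisy_sum_mgf model A2 df fM uhs hsH mg gB gs uB ub.
  have -> : (\int[P]_w (expR (e * (th * S w)))%:E)%E =
    (\int[P]_w (expR (e * u * \sum_(i < n) (g (X i w) - \int[mu]_x (g x * f x) +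
      \sum_(h <- hs) b h * W i h w)))%:E)%E.
    apply: eq_integral => w _; rewrite SE; congr (expR _)%:E.
    by rewrite /u !mulrA.
  move=> /le_trans; apply; rewrite lee_fin ler_expR eu2 u2.
  rewrite [leLHS](_ : _ = A * tau ^+ 2 * l / V ^+ 2 *
    ((M * s + \sum_(h <- hs) b h ^+ 2) / n%:R)); last first.
    by field; rewrite !gt_eqF.
  apply: (@le_trans _ _ (A * tau ^+ 2 * l / V ^+ 2 * V ^+ 2)).
    rewrite ler_wpM2l// divr_ge0 ?mulr_ge0 ?sqr_ge0//; lra.
  by rewrite divfK// gt_eqF.
split.
  have := key 1; rewrite expr1n => /(_ erefl).
  by under eq_integral do rewrite mul1r.
have := key (-1); rewrite sqrrN expr1n => /(_ erefl).
by under eq_integral do rewrite mulN1r.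
Qed.

End Deviations.

Section EstimatorDeviations.
Context {R : realType} (K : R -> R) (hK : is_kernel K).
Notation mu := (@lebesgue_measure R).

Lemma v_sqr (M c h : R) n : 0 <= M -> 0 <= h ->
  v K M c n h ^+ 2 = M * L2sq K / (n%:R * h) + c ^+ 2 / (n%:R * h ^+ 2).
Proof.
move=> M0 h0; rewrite sqr_sqrtr// addr_ge0//; apply: divr_ge0.
- by rewrite mulr_ge0// L2sq_ge0.
- by rewrite mulr_ge0.
- exact: sqr_ge0.
- by rewrite mulr_ge0// sqr_ge0.
Qed.

Lemma v_gt0 (M c h : R) n : 0 < M -> 0 < h -> (0 < n)%N -> 0 < v K M c n h.
Proof.
move=> M0 h0 n0; rewrite sqrtr_gt0 ltr_wpDr//.
  by rewrite divr_ge0 ?sqr_ge0// mulr_ge0// sqr_ge0.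
by rewrite divr_gt0// mulr_gt0 ?ltr0n// L2sq_gt0.
Qed.

Lemma v2_sqr (M c h eta : R) n : 0 <= M ->
  v2 K M c n h eta ^+ 2 = M / n%:R * L2dist K h eta
    + c ^+ 2 / (n%:R * h ^+ 2) + c ^+ 2 / (n%:R * eta ^+ 2).
Proof.
move=> M0; rewrite sqr_sqrtr// !addr_ge0//.
- by rewrite mulr_ge0 ?divr_ge0//; exact: L2dist_ge0.
- by rewrite divr_ge0 ?sqr_ge0// mulr_ge0// sqr_ge0.
- by rewrite divr_ge0 ?sqr_ge0// mulr_ge0// sqr_ge0.
Qed.

(** These are the two lower bounds that [scaled_noisy_sum_mgf] asks of the variance of a difference.
    The first rests on the gap [a * eta <= h], without which the two kernels could nearly cancel. *)
Lemma v2_ge (a M c h eta : R) n : 1 < a -> 0 < M -> (0 < n)%N ->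
  0 < eta -> a * eta <= h ->
  M * (sep_const a * L2sq K) / (n%:R * eta) <= v2 K M c n h eta ^+ 2 /\
  c ^+ 2 / (n%:R * eta ^+ 2) <= v2 K M c n h eta ^+ 2.
Proof.
move=> a1 M0 n0 eta0 aeta; rewrite v2_sqr ?(ltW M0)//.
have N0 : 0 < n%:R :> R by rewrite ltr0n.
have c1 (x : R) : 0 <= c ^+ 2 / (n%:R * x ^+ 2).
  by rewrite divr_ge0 ?sqr_ge0// mulr_ge0// sqr_ge0.
have D0 : 0 <= M / n%:R * L2dist K h eta.
  by rewrite mulr_ge0 ?divr_ge0 ?(ltW M0)//; exact: L2dist_ge0.
split; last by rewrite lerDr addr_ge0.
have := L2dist_ge hK a1 eta0 aeta.
have MN : 0 < M / n%:R by rewrite divr_gt0.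
rewrite -(ler_pM2l MN) => sep; rewrite -addrA ler_wpDr ?addr_ge0//.
apply: le_trans sep; rewrite le_eqVlt; apply/orP; left.
by apply/eqP; field; rewrite !gt_eqF.
Qed.

Context d (T : measurableType d) (P : probability T R).
Variables (A M B t c : R) (n : nat) (Hn : set R) (f : R -> R).
Variables (X : 'I_n -> T -> R) (W Z : 'I_n -> R -> T -> R).
Hypotheses (model : noise_model P A Hn f X W) (A2 : 2 <= A).
Hypotheses (df : is_density f) (M0 : 0 < M) (fM : forall x, f x <= M).
Hypothesis ZE : forall i h w, Hn h ->
  Z i h w = Kh K h (X i w - t) + c / h * W i h w.
Hypotheses (KB : forall u, `|K u| <= B) (n0 : (0 < n)%N).

Definition dev (h : R) (w : T) : R := fhat Z h w - smooth K f h t.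

Let N0 : 0 < n%:R :> R. Proof. by rewrite ltr0n. Qed.

Let Kh_le (h u : R) : 0 < h -> `|Kh K h u| <= B / h.
Proof.
move=> h0; rewrite /Kh normrM [leRHS]mulrC gtr0_norm ?invr_gt0//.
by rewrite ler_wpM2l// invr_ge0 ltW.
Qed.

Let mKht (h : R) : measurable_fun setT (fun x : R => Kh K h (x - t)).
Proof.
apply: measurableT_comp; first exact: measurable_Kh.
exact: measurable_funB.
Qed.

Lemma dev_mgf (tau h : R) : Hn h -> 0 < h -> 1 <= n%:R * h ->
  0 < tau -> tau <= 1 -> 16 * B ^+ 2 * tau ^+ 2 <= M * L2sq K ->
  (\int[P]_w (expR (tau / v K M c n h * dev h w))%:E <=
    (expR (A * tau ^+ 2))%:E)%E /\
  (\int[P]_w (expR (- (tau / v K M c n h * dev h w)))%:E <=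
    (expR (A * tau ^+ 2))%:E)%E.
Proof.
move=> Hh h0 nh tau0 tau1 Btau.
have c0 (x : R) : 0 <= c ^+ 2 / (n%:R * x ^+ 2).
  by rewrite divr_ge0 ?sqr_ge0// mulr_ge0// sqr_ge0.
have ML : 0 <= M * L2sq K / (n%:R * h).
  by rewrite divr_ge0// mulr_ge0 ?L2sq_ge0// ltW.
have [] := @scaled_noisy_sum_mgf R d T P A M B (L2sq K / h) 1 tau
  (v K M c n h) (M * L2sq K) h c n Hn f (fun x => Kh K h (x - t)) X W [:: h]
  (fun=> c / h) model A2 df fM isT _ (mKht h) _ _ _ n0 h0
  (v_gt0 c M0 h0 n0) ler01 nh _ tau0 tau1 Btau _ _ _ (dev h) _.
- by move=> x; rewrite inE => /eqP ->.
- move=> x; apply: le_trans (Kh_le _ h0) _.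
  rewrite ler_wpM2r ?invr_ge0 ?(ltW h0)//.
  by have := normr_ge0 (K 0); have := KB 0; lra.
- by rewrite integral_Kh_sqr.
- by move=> x _; rewrite exprMn exprVn.
- by rewrite ler1n.
- by rewrite v_sqr ?(ltW M0) ?(ltW h0)// lerDl.
- by rewrite v_sqr ?(ltW M0) ?(ltW h0)// lerDr.
- rewrite big_seq1 v_sqr ?(ltW M0) ?(ltW h0)// le_eqVlt; apply/orP; left.
  by apply/eqP; field; rewrite !gt_eqF.
- move=> w; rewrite /dev /fhat /smooth gt_eqF//.
  under eq_bigr do rewrite ZE//.
  rewrite [in RHS](eq_bigr (fun i => Kh K h (X i w - t) + c / h * W i h w -
    \int[mu]_x (Kh K h (x - t) * f x))); last first.
    by move=> i _; rewrite big_seq1 addrAC.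
  rewrite sumrB sumr_const card_ord mulrBr; congr (_ - _).
  by rewrite -[X in _ = _ * X]mulr_natl mulKf ?gt_eqF.
by rewrite sqrtr1 !mulr1.
Qed.

Lemma dev_diff_mgf (a tau l h eta : R) : 1 < a -> Hn h -> Hn eta -> 0 < eta ->
  eta <= 1 -> a * eta <= h -> 0 <= l -> l <= n%:R * eta ->
  0 < tau -> tau <= 1 -> 16 * B ^+ 2 * tau ^+ 2 <= M * (sep_const a * L2sq K) ->
  let th := tau * Num.sqrt l / v2 K M c n h eta in
  (\int[P]_w (expR (th * (dev h w - dev eta w)))%:E <=
    (expR (A * tau ^+ 2 * l))%:E)%E /\
  (\int[P]_w (expR (- (th * (dev h w - dev eta w))))%:E <=
    (expR (A * tau ^+ 2 * l))%:E)%E.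
Proof.
move=> a1 Hh Heta eta0 eta1 aeta l0 leta tau0 tau1 Btau th.
have etah : eta < h by apply: lt_le_trans aeta; rewrite ltr_pMl.
have h0 := lt_trans eta0 etah.
have [v2K v2c] := v2_ge c a1 M0 n0 eta0 aeta.
have B0 : 0 <= B by apply: le_trans (KB 0); exact: normr_ge0.
have v20 : 0 < v2 K M c n h eta.
  rewrite lt0r sqrtr_ge0 andbT; apply/eqP => v0; move: v2K.
  rewrite v0 expr0n /= leNgt => /negP; apply.
  rewrite divr_gt0//; last exact: mulr_gt0.
  by rewrite mulr_gt0// mulr_gt0 ?sep_const_gt0// L2sq_gt0.
(* Both estimators use the same [X i], so their signals merge into one function; their noises are
   independent and remain two terms of opposite sign. *)
pose g x := Kh K h (x - t) - Kh K eta (x - t).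
pose b x := if x == h then c / h else - (c / eta).
apply: (@scaled_noisy_sum_mgf R d T P A M B (L2dist K h eta) l tau
  (v2 K M c n h eta) (M * (sep_const a * L2sq K)) eta c n Hn f g X W
  [:: h; eta] b model A2 df fM _ _ _ _ _ _ n0 eta0 v20 l0 leta _ tau0 tau1
  Btau v2K v2c _ (fun w => dev h w - dev eta w) _).
- by rewrite /= inE gt_eqF.
- by move=> x; rewrite !inE => /orP[]/eqP ->.
- by apply: measurable_funB; exact: mKht.
- move=> x; apply: le_trans (ler_normB _ _) _.
  have := Kh_le (x - t) h0; have := Kh_le (x - t) eta0.
  have : B / h <= B / eta by rewrite ler_wpM2l// lef_pV2// ltW.
  by lra.
- by rewrite integral_Kh_dist.
- move=> x; rewrite !inE => /orP[]/eqP ->; rewrite /b ?eqxx ?lt_eqF//.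
    rewrite exprMn exprVn ler_wpM2l ?sqr_ge0// lef_pV2 ?posrE ?exprn_gt0//.
    by rewrite ler_pXn2r// ?nnegrE ltW.
  by rewrite sqrrN exprMn exprVn.
- by rewrite (le_trans leta)// ler_piMr.
- rewrite big_cons big_seq1 /b eqxx lt_eqF// v2_sqr ?(ltW M0)//.
  rewrite le_eqVlt; apply/orP; left.
  by apply/eqP; field; rewrite !gt_eqF.
- move=> w; rewrite /dev /fhat /smooth !gt_eqF//.
  under eq_bigr do rewrite ZE//.
  under [in X in _ - (X - _)]eq_bigr do rewrite ZE//.
  have -> : \int[mu]_x (g x * f x) = \int[mu]_x (Kh K h (x - t) * f x) -
      \int[mu]_x (Kh K eta (x - t) * f x).
    rewrite -RintegralB//.
    - by apply: eq_Rintegral => x _; rewrite mulrBl.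
    - by apply: (@integrable_bounded_density _ _ _ (B / h)) => // x; exact: Kh_le.
    - by apply: (@integrable_bounded_density _ _ _ (B / eta)) => // x; exact: Kh_le.
  set I1 := \int[mu]_x _; set I2 := \int[mu]_x _.
  rewrite [in RHS](eq_bigr (fun i => (Kh K h (X i w - t) + c / h * W i h w) -
    (Kh K eta (X i w - t) + c / eta * W i eta w) - (I1 - I2))); last first.
    move=> i _; rewrite big_cons big_seq1 /b eqxx lt_eqF// /g; ring.
  rewrite !sumrB !sumr_const !card_ord -(mulr_natl I1 n) -(mulr_natl I2 n).
  by field; rewrite gt_eqF.
Qed.

End EstimatorDeviations.

(** * Bandwidth grid *)

Section Grid.
Context {R : realType}.

(** Larger indices are smaller bandwidths, so maxima over the grid become minima over exponents. *)
Definition level (a hbar : R) (j : nat) : R := a ^- j * hbar.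

Lemma exprn_ge1Dn (a : R) j : 1 <= a -> 1 + j%:R * (a - 1) <= a ^+ j.
Proof.
move=> a1; elim: j => [|j IH]; first by rewrite mul0r addr0 expr0.
have aj1 : 1 <= a ^+ j by exact: exprn_ege1.
by rewrite exprS -natr1; move: aj1 IH; set x := a ^+ j; nra.
Qed.

Lemma level_gt0 (a hbar : R) j : 0 < a -> 0 < hbar -> 0 < level a hbar j.
Proof. by move=> a0 h0; rewrite mulr_gt0// invr_gt0 exprn_gt0. Qed.

Lemma levelS (a hbar : R) j : 0 < a -> a * level a hbar j.+1 = level a hbar j.
Proof. by move=> a0; rewrite /level exprS invfM !mulrA mulfV ?gt_eqF// mul1r. Qed.

Lemma level_le (a hbar : R) j k : 1 < a -> 0 < hbar -> (j <= k)%N ->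
  level a hbar k <= level a hbar j.
Proof.
move=> a1 h0 jk; rewrite ler_pM2r// lef_pV2 ?posrE ?exprn_gt0//; last 2 first.
- lra.
- lra.
by rewrite ler_eXn2l.
Qed.

Lemma level_le_top (a hbar : R) j : 1 < a -> 0 < hbar -> level a hbar j <= hbar.
Proof.
move=> a1 h0; have := level_le a1 h0 (leq0n j).
by rewrite {2}/level expr0 invr1 mul1r.
Qed.

Lemma level_lt (a hbar : R) j k : 1 < a -> 0 < hbar ->
  (level a hbar k < level a hbar j) = (j < k)%N.
Proof.
move=> a1 h0; have a0 : 0 < a by lra.
by rewrite ltr_pM2r// ltf_pV2 ?posrE ?exprn_gt0// ltr_eXn2l.
Qed.

Lemma ln_level (a hbar : R) j : 1 < a -> 0 < hbar ->
  ln (hbar / level a hbar j) = j%:R * ln a.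
Proof.
move=> a1 h0; have a0 : 0 < a by lra.
rewrite /level invfM invrK mulrCA mulfV ?gt_eqF// mulr1 lnXn//.
by rewrite mulr_natl.
Qed.

Lemma hlow_gt0 (hbar : R) n : (0 < n)%N -> 0 < hlow hbar n.
Proof.
by move=> n0; rewrite divr_gt0 ?sqrtr_gt0 ?ltr0n// lt_max ltr01 orbT.
Qed.

Lemma grid_hlow_le (a hbar : R) n : grid a hbar n !=set0 -> hlow hbar n <= hbar.
Proof. by case=> h [/andP[+ +] _]; exact: le_trans. Qed.

Lemma grid_levels (a hbar : R) n : 1 < a -> (0 < n)%N ->
  grid a hbar n !=set0 ->
  exists J, [/\ hlow hbar n <= level a hbar J,
    level a hbar J.+1 < hlow hbar n &
    forall h, grid a hbar n h <-> exists2 j, (j <= J)%N & h = level a hbar j].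
Proof.
move=> a1 n0 g0; have lowbar := grid_hlow_le g0.
have low0 := hlow_gt0 hbar n0; have bar0 := lt_le_trans low0 lowbar.
have a0 : 0 < a by lra.
pose Q j := hlow hbar n <= level a hbar j.
have exQ : exists j, Q j by exists 0%N; rewrite /Q /level expr0 invr1 mul1r.
(* By Bernoulli's inequality the powers of a grow at least linearly, which bounds the exponents of
   the grid. *)
have Qbound j : Q j -> (j <= Num.truncn (hbar / hlow hbar n / (a - 1)))%N.
  rewrite /Q /level mulrC ler_pdivlMr ?exprn_gt0// => Qj.
  rewrite truncn_ge_nat; last first.
    by rewrite divr_ge0 ?subr_ge0 ?(ltW a1)// divr_ge0 ?(ltW bar0) ?(ltW low0).
  rewrite ler_pdivlMr ?subr_gt0// ler_pdivlMr//.
  have := exprn_ge1Dn j (ltW a1); move: Qj.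
  by rewrite mulrC => Qj; nra.
have [J QJ maxJ] := ex_maxnP exQ Qbound.
exists J; split=> //.
  by rewrite ltNge; apply/negP => /maxJ; rewrite ltnn.
move=> h; split=> [[/andP[hl hb] [j hj]]|[j jJ ->]].
  by exists j => //; apply: maxJ; rewrite /Q /level -hj.
split; last by exists j.
rewrite (le_trans QJ) ?level_le//=.
exact: level_le_top.
Qed.

(** The form of [hlow] enters here. With r the square root of n, its entry 1 gives h >= 1 / r, hence
    hbar / h <= hbar r; its logarithmic entry gives n h >= r h >= ln (hbar r). *)
Lemma log_le_nh (hbar h : R) n : (0 < n)%N -> 0 < hbar ->
  hlow hbar n <= h ->
  [/\ 1 <= n%:R * h, ln (hbar / h) <= ln (hbar * Num.sqrt n%:R) &
      ln (hbar / h) <= n%:R * h].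
Proof.
move=> n0 bar0 lowh.
have N0 : 0 < n%:R :> R by rewrite ltr0n.
have s1 : 1 <= Num.sqrt n%:R :> R.
  by rewrite -[leLHS]sqrtr1 ler_wsqrtr// ler1n.
set r := Num.sqrt n%:R; have r1 : 1 <= r by [].
have r0 : 0 < r by lra.
have NE : n%:R = r * r :> R by rewrite -expr2 sqr_sqrtr// ltW.
set mx := Num.max (ln (hbar * r)) 1.
have mx1 : 1 <= mx by rewrite le_max lexx orbT.
have mxl : ln (hbar * r) <= mx by rewrite le_max lexx.
have lowE : hlow hbar n * r = mx by rewrite /hlow divfK ?gt_eqF.
have low0 := hlow_gt0 hbar n0.
have h0 : 0 < h by exact: lt_le_trans lowh.
have mxh : mx <= n%:R * h.
  rewrite NE -mulrA; apply: (@le_trans _ _ (r * h)).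
    by rewrite -lowE mulrC ler_pM2l.
  by rewrite ler_peMl// mulr_ge0 ?(ltW r0) ?(ltW h0).
have lnl : ln (hbar / h) <= ln (hbar * r).
  rewrite ler_ln ?posrE ?divr_gt0 ?mulr_gt0// ler_pM2l//.
  rewrite -[leRHS]invrK lef_pV2 ?posrE ?invr_gt0//.
  apply: le_trans lowh; rewrite -(ler_pM2r r0) lowE mulVf//.
  by rewrite gt_eqF.
split=> //; first exact: le_trans mxh.
by apply: le_trans lnl _; exact: le_trans mxh.
Qed.

End Grid.

Section Monotonicity.
Context {R : realType} (K : R -> R) (hK : is_kernel K).

Lemma ln_ratio_ge0 (hbar h : R) : 0 < h -> h <= hbar -> 0 <= ln (hbar / h).
Proof. by move=> h0 hb; rewrite ln_ge0// ler_pdivlMr// mul1r. Qed.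

Lemma lambda_ge1 (kappa hbar h : R) : 1 <= lambda kappa hbar h.
Proof. by rewrite le_max lexx. Qed.

Lemma lambda_sqr (kappa hbar h : R) : 0 <= kappa -> 0 < h -> h <= hbar ->
  lambda kappa hbar h ^+ 2 = Num.max 1 (kappa * ln (hbar / h)).
Proof.
move=> k0 h0 hb; have := mulr_ge0 k0 (ln_ratio_ge0 h0 hb).
set x := kappa * _ => x0; rewrite /lambda -/x.
have [x1|x1] := leP 1 x.
  rewrite max_r ?sqr_sqrtr// -[leLHS]sqrtr1; exact: ler_wsqrtr.
by rewrite max_l ?expr1n// -[leRHS]sqrtr1 ler_wsqrtr// ltW.
Qed.

Lemma lambda_le (kappa hbar h h' : R) : 0 <= kappa -> 0 < hbar -> 0 < h ->
  h <= h' -> lambda kappa hbar h' <= lambda kappa hbar h.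
Proof.
move=> k0 b0 h0 hh'; rewrite /lambda ge_max le_max lexx /= le_max.
have h'0 := lt_le_trans h0 hh'.
apply/orP; right; apply: ler_wsqrtr; rewrite ler_wpM2l//.
by rewrite ler_ln ?posrE ?divr_gt0// ler_pM2l// lef_pV2.
Qed.

(** The kernel part of the variance scales like 1 / h and the privacy part like 1 / h^2; the larger
    exponent serves both. *)
Lemma v_sqr_scale (M c h h' : R) n : 0 < M -> (0 < n)%N -> 0 < h -> h <= h' ->
  v K M c n h ^+ 2 <= (h' / h) ^+ 2 * v K M c n h' ^+ 2.
Proof.
move=> M0 n0 h0 hh'; have h'0 := lt_le_trans h0 hh'.
have N0 : 0 < n%:R :> R by rewrite ltr0n.
have L0 : 0 < L2sq K by exact: L2sq_gt0.
rewrite !v_sqr ?(ltW M0) ?(ltW h0) ?(ltW h'0)// mulrDr lerD//; last first.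
  by rewrite le_eqVlt; apply/orP; left; apply/eqP; field; rewrite !gt_eqF.
rewrite (_ : (h' / h) ^+ 2 * _ = (h' / h) * (M * L2sq K / (n%:R * h))).
  rewrite ler_peMl//; first by rewrite divr_ge0// ltW// mulr_gt0.
  by rewrite ler_pdivlMr// mul1r.
by field; rewrite !gt_eqF.
Qed.

Lemma v_le (M c h h' : R) n : 0 < M -> (0 < n)%N -> 0 < h -> h <= h' ->
  v K M c n h' <= v K M c n h.
Proof.
move=> M0 n0 h0 hh'; have h'0 := lt_le_trans h0 hh'.
have N0 : 0 < n%:R :> R by rewrite ltr0n.
apply: ler_wsqrtr; apply: lerD; apply: ler_wpM2l.
- by rewrite mulr_ge0// ?L2sq_ge0// ltW.
- by rewrite lef_pV2 ?posrE ?mulr_gt0// ler_pM2l.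
- exact: sqr_ge0.
- rewrite lef_pV2 ?posrE ?mulr_gt0 ?exprn_gt0// ler_pM2l//.
  by rewrite ler_pXn2r ?nnegrE ?(ltW h0) ?(ltW h'0).
Qed.

Lemma v2_le (M c h eta : R) n : 0 < M -> (0 < n)%N -> 0 < eta -> eta <= h ->
  v2 K M c n h eta <= 2 * v K M c n eta.
Proof.
move=> M0 n0 eta0 etah; have h0 := lt_le_trans eta0 etah.
have N0 : 0 < n%:R :> R by rewrite ltr0n.
have veta := v_gt0 hK c M0 eta0 n0.
rewrite -(@ler_pXn2r _ 2)// ?nnegrE ?sqrtr_ge0//; last by rewrite mulr_ge0// ltW.
have vle : v K M c n h ^+ 2 <= v K M c n eta ^+ 2.
  by rewrite ler_pXn2r ?nnegrE ?sqrtr_ge0// v_le.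
rewrite exprMn v2_sqr ?(ltW M0)//.
move: vle; rewrite !v_sqr ?(ltW M0) ?(ltW h0) ?(ltW eta0)// => vle.
have : M / n%:R * L2dist K h eta <=
    M / n%:R * (2 * (L2sq K / h) + 2 * (L2sq K / eta)).
  by rewrite ler_pM2l ?divr_gt0// L2dist_le.
have -> : M / n%:R * (2 * (L2sq K / h) + 2 * (L2sq K / eta)) =
    2 * (M * L2sq K / (n%:R * h)) + 2 * (M * L2sq K / (n%:R * eta)).
  by field; rewrite !gt_eqF.
have c0 (x : R) : 0 <= c ^+ 2 / (n%:R * x ^+ 2).
  by rewrite divr_ge0 ?sqr_ge0// mulr_ge0// sqr_ge0.
move: vle (c0 h) (c0 eta).
set p := M * L2sq K / _; set q := M * L2sq K / (_ * eta).
set x := c ^+ 2 / _; set y := c ^+ 2 / (_ * eta ^+ 2); set D := M / _ * _.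
lra.
Qed.

Lemma psi_le (M c kappa hbar h eta : R) n : 0 < M -> (0 < n)%N -> 0 <= kappa ->
  0 < hbar -> 0 < eta -> eta <= h ->
  psi K M c n kappa hbar h eta <=
  3 * (v K M c n eta * lambda kappa hbar eta).
Proof.
move=> M0 n0 k0 b0 eta0 etah; have h0 := lt_le_trans eta0 etah.
have l0 : 0 <= lambda kappa hbar eta by apply: le_trans (lambda_ge1 _ _ _).
have l0' : 0 <= lambda kappa hbar h by apply: le_trans (lambda_ge1 _ _ _).
have : v K M c n h * lambda kappa hbar h <= v K M c n eta * lambda kappa hbar eta.
  by apply: ler_pM; rewrite ?sqrtr_ge0 ?v_le ?lambda_le.
have := ler_wpM2r l0 (v2_le c M0 n0 eta0 etah).
by rewrite /psi -mulrA; lra.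
Qed.

End Monotonicity.

(** * Lepski's selection rule *)

Section Lepski.
Context {R : realType}.

(** Shared by [hhat] and [hstar]. The failure of [Q] at all smaller exponents is the source of the
    rejections used later. *)
Lemma sup_grid_level (a hbar : R) n J (Q : R -> Prop) : 1 < a -> 0 < hbar ->
  (forall h, grid a hbar n h <-> exists2 j, (j <= J)%N & h = level a hbar j) ->
  (exists2 j, (j <= J)%N & Q (level a hbar j)) ->
  exists j, [/\ (j <= J)%N, Q (level a hbar j),
    forall i, (i < j)%N -> ~ Q (level a hbar i) &
    sup [set h | grid a hbar n h /\ Q h] = level a hbar j].
Proof.
move=> a1 b0 gridE [j0 j0J Qj0].
have exQ : exists j, `[< Q (level a hbar j) >] by exists j0; apply/asboolP.
have [j /asboolP Qj minj] := ex_minnP exQ.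
have jJ : (j <= J)%N by apply: leq_trans (minj _ _) j0J; exact/asboolP.
exists j; split=> // [i ij Qi|].
  by move: ij; rewrite ltnNge minj//; exact/asboolP.
have Sj : [set h | grid a hbar n h /\ Q h] (level a hbar j).
  by split=> //; apply/gridE; exists j.
have ubj : ubound [set h | grid a hbar n h /\ Q h] (level a hbar j).
  move=> _ [/gridE[i iJ ->] Qi]; apply: level_le => //.
  by apply: minj; exact/asboolP.
apply/eqP; rewrite eq_le; apply/andP; split.
  by apply: ge_sup => //; exists (level a hbar j).
by apply: ub_le_sup => //; exists (level a hbar j).
Qed.

(** Here j stands for the selected index, [j.-1] for the rejected bandwidth just above it, and l for
    a witness of the rejection. Summing over all pairs removes the dependence on the random
    selection. The factor 2 comes from splitting the error into noise and bias. *)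
Definition rejection_term (k : nat) (x : nat -> R) (pw : nat -> nat -> R)
    (j l : nat) : R :=
  if (k < j <= l)%N && (pw j.-1 l < `|x j.-1 - x l|) then 2 * x j ^+ 2 else 0.

(* The error of the selected index jhat: if jhat <= k, stopping at jhat means
   that F jhat is close to F k; if k < jhat, the rejection of jhat - 1 means that
   some noise difference exceeded its threshold although the bias is small. *)
Lemma lepski_pointwise (J k jhat : nat) (F fb vl : nat -> R) (pw : nat -> nat -> R)
    (f L : R) :
  (k <= J)%N -> (jhat <= J)%N ->
  (forall j, 0 <= vl j) -> (forall j l, 0 <= pw j l) ->
  (forall j, (k <= j)%N -> vl k <= vl j) ->
  (forall j, (j <= k)%N -> vl j + pw j k <= 3 * vl k) ->
  `|fb k - f| <= L * vl k ->
  ((k < J)%N -> forall l, (k <= l <= J)%N -> `|fb l - f| <= vl k / 2) ->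
  (forall l, (jhat <= l <= J)%N -> `|F jhat - F l| <= vl jhat + pw jhat l) ->
  (forall i, (i < jhat)%N -> ~ (forall l, (i <= l <= J)%N ->
     `|F i - F l| <= vl i + pw i l)) ->
  (F jhat - f) ^+ 2 <= (28 + 3 * L ^+ 2) * vl k ^+ 2 + 3 * (F k - fb k) ^+ 2 +
    \sum_(j < J.+1) \sum_(l < J.+1) rejection_term k (fun i => F i - fb i) pw j l.
Proof.
move=> kJ jJ vl0 pw0 vlk psk biask bias ok nok.
set G := rejection_term k _ pw.
have G0 j l : 0 <= G j l.
  by rewrite /G /rejection_term; case: ifP => // _; rewrite mulr_ge0// sqr_ge0.
have Sum0 : 0 <= \sum_(j < J.+1) \sum_(l < J.+1) G j l.
  by apply: sumr_ge0 => j _; apply: sumr_ge0 => l _; exact: G0.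
have sqle (x y : R) : `|x| <= y -> x ^+ 2 <= y ^+ 2.
  move=> xy; rewrite -real_normK ?num_real// ler_pXn2r ?nnegrE//.
  exact: le_trans xy.
have [jk|kj] := leqP jhat k.
  (* This factor 3 and the split into three terms below make up 27 of the 28 in front of
     [vl k ^+ 2]; the other case needs only 1/2. *)
  have d1 : `|F jhat - F k| <= 3 * vl k.
    by apply: le_trans (ok k _) (psk _ jk); rewrite jk.
  have := sqle _ _ d1; have := sqle _ _ biask; rewrite !exprMn.
  have -> : F jhat - f = (F jhat - F k) + (F k - fb k) + (fb k - f) by ring.
  set x := F jhat - F k; set y := F k - fb k; set z := fb k - f.
  set V := vl k ^+ 2 => hz hx.
  have V0 : 0 <= V by exact: sqr_ge0.
  have : (x + y + z) ^+ 2 <= 3 * (x ^+ 2 + y ^+ 2 + z ^+ 2).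
    have := sqr_ge0 (x - y); have := sqr_ge0 (y - z); have := sqr_ge0 (x - z).
    by rewrite !expr2; lra.
  by move: Sum0; set Sm := \sum_(j < _) _; lra.
have jhat0 : (0 < jhat)%N by exact: leq_ltn_trans kj.
(* For k = J this case cannot occur; therefore [bias] is asked only for k < J. *)
have kltJ : (k < J)%N by exact: leq_trans jJ.
have predj : (jhat.-1 < jhat)%N by rewrite prednK.
have kpred : (k <= jhat.-1)%N by rewrite -ltnS prednK.
have [l /andP[jl lJ] Fl] : exists2 l, (jhat.-1 <= l <= J)%N &
    vl jhat.-1 + pw jhat.-1 l < `|F jhat.-1 - F l|.
  apply: contrapT => no; apply: (nok _ predj) => l lin.
  by rewrite leNgt; apply/negP => lt; apply: no; exists l.
(* The witness is not the rejected index itself, where the difference vanishes. The gap of one level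
   thus obtained is what separates the two kernels. *)
have jhatl : (jhat <= l)%N.
  rewrite leqNgt; apply/negP => ltlj.
  have lE : l = jhat.-1.
    by apply/eqP; rewrite eqn_leq jl andbT -ltnS prednK.
  by move: Fl; rewrite lE subrr normr0 ltNge addr_ge0.
have b1 := bias kltJ jhat.-1; have b2 := bias kltJ l; have b3 := bias kltJ jhat.
have {}b1 : `|fb jhat.-1 - f| <= vl k / 2.
  by apply: b1; rewrite kpred (leq_trans (leq_pred _)).
have {}b2 : `|fb l - f| <= vl k / 2.
  by apply: b2; rewrite lJ andbT (leq_trans (ltnW kj)).
have {}b3 : `|fb jhat - f| <= vl k / 2 by apply: b3; rewrite jJ andbT ltnW.
(* The threshold contains [vl jhat.-1], at least [vl k]. It absorbs the two biases of at most
   [vl k / 2] each and leaves [pw] to the noise. *)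
have far : pw jhat.-1 l < `|(F jhat.-1 - fb jhat.-1) - (F l - fb l)|.
  have := ler_normB (F jhat.-1 - fb jhat.-1 - (F l - fb l))
    (- ((fb jhat.-1 - f) - (fb l - f))).
  rewrite (_ : _ - - _ = F jhat.-1 - F l); last by ring.
  rewrite normrN => tri.
  have := ler_normB (fb jhat.-1 - f) (fb l - f).
  by have := vlk _ kpred; lra.
have Gle : 2 * (F jhat - fb jhat) ^+ 2 <= \sum_(j < J.+1) \sum_(l < J.+1) G j l.
  have jJ1 : (jhat < J.+1)%N by rewrite ltnS.
  have lJ1 : (l < J.+1)%N by rewrite ltnS.
  rewrite (bigD1 (Ordinal jJ1))//= (bigD1 (Ordinal lJ1))//=.
  rewrite -addrA {1}/G /rejection_term kj jhatl far /= lerDl addr_ge0//.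
    by apply: sumr_ge0 => ? _; exact: G0.
  by apply: sumr_ge0 => ? _; apply: sumr_ge0 => ? _; exact: G0.
have := sqle _ _ b3.
have -> : F jhat - f = (F jhat - fb jhat) + (fb jhat - f) by ring.
move: Gle; set x := F jhat - fb jhat; set z := fb jhat - f.
set Sm := \sum_(j < _) _; set y := F k - fb k.
have -> : (vl k / 2) ^+ 2 = vl k ^+ 2 / 4 by field.
have V0 : 0 <= vl k ^+ 2 by exact: sqr_ge0.
have LV0 : 0 <= L ^+ 2 * vl k ^+ 2 by rewrite mulr_ge0// sqr_ge0.
have y0 := sqr_ge0 y.
have : (x + z) ^+ 2 <= 2 * x ^+ 2 + 2 * z ^+ 2.
  by have := sqr_ge0 (x - z); rewrite !expr2; lra.
lra.
Qed.

(* AM-GM in place of Cauchy-Schwarz: both factors are dominated by exponential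
   moments, with a free weight eps. *)
Lemma sqr_event_le_exp (x y T theta1 theta2 eps : R) :
  0 < theta1 -> 0 <= theta2 -> 0 < eps ->
  (if T < `|y| then 2 * x ^+ 2 else 0) <=
  eps * (24 / theta1 ^+ 4) * (expR (theta1 * x) + expR (- (theta1 * x))) +
  eps^-1 * expR (- (theta2 * T)) * (expR (theta2 * y) + expR (- (theta2 * y))).
Proof.
move=> t10 t20 e0.
have E0 (z : R) := ltW (expR_gt0 z).
have ei0 : 0 <= eps^-1 by rewrite invr_ge0 ltW.
have t14 : 0 <= 24 / theta1 ^+ 4 by rewrite divr_ge0// exprn_ge0// ltW.
have A0 : 0 <= eps * (24 / theta1 ^+ 4) *
    (expR (theta1 * x) + expR (- (theta1 * x))).
  by rewrite mulr_ge0 ?addr_ge0// mulr_ge0// ltW.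
case: ifPn => [Ty|_]; last by rewrite addr_ge0// !mulr_ge0// addr_ge0.
have B1 : 1 <= expR (- (theta2 * T)) *
    (expR (theta2 * y) + expR (- (theta2 * y))).
  rewrite mulrDr -!expRD.
  have [y0|y0] := leP 0 y.
    rewrite ger0_norm// in Ty; rewrite ler_wpDr// -expR0 ler_expR.
    by have := ler_wpM2l t20 (ltW Ty); lra.
  rewrite ltr0_norm// in Ty; rewrite ler_wpDl// -expR0 ler_expR.
  by have := ler_wpM2l t20 (ltW Ty); lra.
(* The 24 is 4!, from the Taylor term of degree 4 of the exponential. *)
have X4 : x ^+ 4 <= 24 / theta1 ^+ 4 *
    (expR (theta1 * x) + expR (- (theta1 * x))).
  have pos (z : R) : 0 <= z -> z ^+ 4 / 24 <= expR z.
    move=> z0; have := expR_ge1Dxn 3 z0; rewrite !factS fact0 /=.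
    by move: (expR z) => e; rewrite -/(24%N); lra.
  rewrite mulrAC ler_pdivlMr ?exprn_gt0// -exprMn [x * _]mulrC.
  have [z0|z0] := leP 0 (theta1 * x).
    have := pos _ z0; have := E0 (- (theta1 * x)); set z := theta1 * x.
    by set e1 := expR z; set e2 := expR (- z); lra.
  have := pos (- (theta1 * x)); rewrite oppr_ge0 => /(_ (ltW z0)).
  have -> : (- (theta1 * x)) ^+ 4 = (theta1 * x) ^+ 4 by ring.
  have := E0 (theta1 * x); set z := theta1 * x.
  by set e1 := expR z; set e2 := expR (- z); lra.
have : 2 * x ^+ 2 <= eps * x ^+ 4 + eps^-1.
  have := sqr_ge0 (eps * x ^+ 2 - 1).
  rewrite -(@pmulr_rge0 _ eps^-1) ?invr_gt0// => h.
  rewrite -subr_ge0 (_ : _ - _ = eps^-1 * (eps * x ^+ 2 - 1) ^+ 2)//.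
  by field; rewrite gt_eqF.
have := ler_wpM2l (ltW e0) X4; have := ler_wpM2l ei0 B1.
rewrite !mulrA mulr1; lra.
Qed.

End Lepski.

(** * Nonnegative majorants and their means *)

Section MeanBounds.
Context {R : realType} d (T : measurableType d) (P : probability T R).

(** Measurability and sign travel with the bound, so that majorants can be added and scaled without
    separate side conditions. *)
Definition mean_le (g : T -> R) (b : R) : Prop :=
  [/\ measurable_fun setT g, forall w, 0 <= g w &
      (\int[P]_w (g w)%:E <= b%:E)%E].

Lemma mean_le_trans (g : T -> R) (b b' : R) : b <= b' ->
  mean_le g b -> mean_le g b'.
Proof. by move=> bb' [mg g0 gb]; split=> //; rewrite (le_trans gb)// lee_fin. Qed.

Lemma mean_le_cst (r : R) : 0 <= r -> mean_le (fun=> r) r.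
Proof.
move=> r0; split=> //.
rewrite (integral_cst P measurableT r%:E) -[leRHS]mule1.
by rewrite -(probability_setT P).
Qed.

Lemma mean_leD (g g' : T -> R) (b b' : R) :
  mean_le g b -> mean_le g' b' -> mean_le (fun w => g w + g' w) (b + b').
Proof.
move=> [mg g0 gb] [mg' g0' gb']; split.
- exact: measurable_funD.
- by move=> w; rewrite addr_ge0.
- under eq_integral do rewrite EFinD.
  rewrite ge0_integralD//; first by rewrite EFinD leeD.
  + by move=> w _; rewrite lee_fin.
  + exact/measurable_EFinP.
  + by move=> w _; rewrite lee_fin.
  + exact/measurable_EFinP.
Qed.

Lemma mean_leZ (r : R) (g : T -> R) (b : R) : 0 <= r ->
  mean_le g b -> mean_le (fun w => r * g w) (r * b).
Proof.
move=> r0 [mg g0 gb]; split.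
- exact: measurable_funM.
- by move=> w; rewrite mulr_ge0.
- under eq_integral do rewrite EFinM.
  rewrite ge0_integralZl//; first by rewrite EFinM lee_wpmul2l.
  + exact/measurable_EFinP.
  + by move=> w _; rewrite lee_fin.
Qed.

Lemma mean_le_sum (N : nat) (g : 'I_N -> T -> R) (b : 'I_N -> R) :
  (forall i, mean_le (g i) (b i)) ->
  mean_le (fun w => \sum_(i < N) g i w) (\sum_(i < N) b i).
Proof.
move=> gb; elim: N g b gb => [|N IH] g b gb.
  rewrite big_ord0 (_ : (fun _ => _) = fun=> 0); last first.
    by apply/funext => w; rewrite big_ord0.
  exact: mean_le_cst.
rewrite big_ord_recl (_ : (fun _ => _) =
  fun w => g ord0 w + \sum_(i < N) g (lift ord0 i) w); last first.
  by apply/funext => w; rewrite big_ord_recl.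
by apply: mean_leD => //; exact: IH.
Qed.

Lemma mean_le_exp_sym (theta b : R) (Y : T -> R) : measurable_fun setT Y ->
  (\int[P]_w (expR (theta * Y w))%:E <= b%:E)%E ->
  (\int[P]_w (expR (- (theta * Y w)))%:E <= b%:E)%E ->
  mean_le (fun w => expR (theta * Y w) + expR (- (theta * Y w))) (2 * b).
Proof.
move=> mY b1 b2; rewrite mulr_natl mulr2n; apply: mean_leD; split=> //.
- by apply: measurableT_comp => //; exact: measurable_funM.
- apply: measurableT_comp => //; apply: measurableT_comp => //.
  exact: measurable_funM.
Qed.

End MeanBounds.

Lemma sum_geom_le {R : realType} (x : R) N : 0 <= x -> x < 1 ->
  \sum_(i < N) x ^+ i <= (1 - x)^-1.
Proof.
move=> x0 x1; have x10 : 0 < 1 - x by rewrite subr_gt0.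
rewrite -[leRHS]mul1r ler_pdivlMr// mulrC -opprB mulNr -subrX1 opprB.
by rewrite lerBlDr lerDl exprn_ge0.
Qed.

Lemma sum_square_powers (R : comPzRingType) (C y : R) N :
  \sum_(j < N) \sum_(l < N) C * (y ^+ j * y ^+ l) =
  C * (\sum_(j < N) y ^+ j) ^+ 2.
Proof.
rewrite expr2 mulr_suml mulr_sumr; apply: eq_bigr => j _.
by rewrite mulr_sumr mulr_sumr.
Qed.

Lemma sqr_le_exp {R : realType} (x theta : R) : 0 < theta ->
  x ^+ 2 <= 2 / theta ^+ 2 * (expR (theta * x) + expR (- (theta * x))).
Proof.
move=> t0.
have pos (z : R) : 0 <= z -> z ^+ 2 / 2 <= expR z.
  move=> z0; have := expR_ge1Dxn 1 z0; rewrite !factS fact0 /=.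
  by move: (expR z) => e; lra.
rewrite mulrAC ler_pdivlMr ?exprn_gt0// -exprMn [x * _]mulrC.
have E0 (z : R) := ltW (expR_gt0 z).
have [z0|z0] := leP 0 (theta * x).
  have := pos _ z0; have := E0 (- (theta * x)); set z := theta * x.
  by set e1 := expR z; set e2 := expR (- z); lra.
have := pos (- (theta * x)); rewrite oppr_ge0 => /(_ (ltW z0)).
have -> : (- (theta * x)) ^+ 2 = (theta * x) ^+ 2 by ring.
have := E0 (theta * x); set z := theta * x.
by set e1 := expR z; set e2 := expR (- z); lra.
Qed.

(** * Risk bound relative to a comparison index k *)

Section OracleBound.
Context {R : realType} (K : R -> R) (hK : is_kernel K).
Context d (T : measurableType d) (P : probability T R).
Variables (a hbar kappa tau A M B L t c : R) (n J k : nat) (f : R -> R).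
Variables (X : 'I_n -> T -> R) (W Z : 'I_n -> R -> T -> R).
Hypotheses (a1 : 1 < a) (hbar0 : 0 < hbar) (hbar1 : hbar <= 1).
Hypotheses (lowJ : hlow hbar n <= level a hbar J)
  (gridE : forall h, grid a hbar n h <->
     exists2 j, (j <= J)%N & h = level a hbar j).
Hypotheses (model : noise_model P A (grid a hbar n) f X W) (A2 : 2 <= A).
Hypotheses (df : is_density f) (M0 : 0 < M) (fM : forall x, f x <= M).
Hypothesis ZE : forall i h w, grid a hbar n h ->
  Z i h w = Kh K h (X i w - t) + c / h * W i h w.
Hypotheses (KB : forall u, `|K u| <= B) (n0 : (0 < n)%N).
Hypotheses (tau0 : 0 < tau) (tau1 : tau <= 1)
  (Btau : 16 * B ^+ 2 * tau ^+ 2 <= M * (sep_const a * L2sq K)).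
Hypotheses (kappa0 : 0 <= kappa)
  (ktau : 8 + A * tau ^+ 2 <= tau * Num.sqrt kappa).

Local Notation H := (level a hbar).
Local Notation vl h := (v K M c n h * lambda kappa hbar h).
Local Notation x := (dev K t f Z).

Hypotheses (kJ : (k <= J)%N)
  (biask : `|smooth K f (H k) t - f t| <= L * vl (H k))
  (bias : (k < J)%N -> forall l, (k <= l <= J)%N ->
     `|smooth K f (H l) t - f t| <= vl (H k) / 2).

Let a0 : 0 < a. Proof. exact: lt_trans a1. Qed.
Let H0 j : 0 < H j. Proof. exact: level_gt0. Qed.
Let HG j : (j <= J)%N -> grid a hbar n (H j).
Proof. by move=> jJ; apply/gridE; exists j. Qed.
Let Hlow j : (j <= J)%N -> hlow hbar n <= H j.
Proof. by move=> jJ; rewrite (le_trans lowJ)// level_le. Qed.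
Let Hbar j : H j <= hbar.
Proof. exact: level_le_top. Qed.
Let Hle j l : (H l <= H j) = (j <= l)%N.
Proof. by rewrite leNgt level_lt// -leqNgt. Qed.
Let lam0 h : 0 <= lambda kappa hbar h.
Proof. by apply: le_trans (lambda_ge1 _ _ _). Qed.

Lemma measurable_dev j : (j <= J)%N -> measurable_fun setT (x (H j)).
Proof.
move=> jJ; apply: measurable_funB => //; apply: measurable_funM => //.
apply: measurable_sum => i.
rewrite (_ : Z i (H j) = fun w => Kh K (H j) (X i w - t) + c / H j * W i (H j) w).
  apply: measurable_funD.
    apply: measurableT_comp; first exact: measurable_Kh.
    by apply: measurable_funB => //; exact: noise_mX model i.
  by apply: measurable_funM => //; exact: noise_mW model i _.
by apply/funext => w; rewrite ZE//; exact: HG.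
Qed.

(** The square of [q l] bounds the rejection event, while one factor [q l] remains after the
    splitting with weight [eps]. *)
Let q l := a ^- l ^+ 4.
(** The 48 is 4! times 2 for the two signs of the exponential; the summand 2 counts the two tails of
    the rejection event. *)
Let C0 := 48 * expR (A * tau ^+ 2) / tau ^+ 4 + 2.
Let E1 := expR (A * tau ^+ 2).

(** As [sep_const a <= 1], a scale [tau] that suits differences also suits single estimators. *)
Let L2M : 16 * B ^+ 2 * tau ^+ 2 <= M * L2sq K.
Proof.
apply: le_trans Btau _; rewrite ler_pM2l// ler_piMl ?L2sq_ge0//.
have d0 : 0 < 2 * a * (a + 1) by apply: mulr_gt0; [apply: mulr_gt0|]; have := a1; lra.
rewrite ler_pdivrMr// mul1r -subr_ge0.
have -> : 2 * a * (a + 1) - (a - 1) ^+ 2 = a ^+ 2 + (4 * a - 1) by ring.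
by rewrite addr_ge0 ?sqr_ge0//; have := a1; lra.
Qed.

Lemma mean_le_dev j : (j <= J)%N ->
  mean_le P (fun w => expR (tau / v K M c n (H j) * x (H j) w) +
    expR (- (tau / v K M c n (H j) * x (H j) w))) (2 * E1).
Proof.
move=> jJ; have [nh _ _] := log_le_nh n0 hbar0 (Hlow jJ).
have [b1 b2] := dev_mgf hK model A2 df M0 fM ZE KB n0 (HG jJ) (H0 j) nh
  tau0 tau1 L2M.
by apply: mean_le_exp_sym => //; exact: measurable_dev.
Qed.

Let pw j l := v2 K M c n (H j) (H l) * lambda kappa hbar (H l).

Lemma mean_le_rejection j l : (k < j)%N -> (j <= l)%N -> (l <= J)%N ->
  exists2 g, mean_le P g (C0 * v K M c n (H k) ^+ 2 * (a^-1 ^+ j * a^-1 ^+ l)) &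
    forall w, rejection_term k (fun i => x (H i) w) pw j l <= g w.
Proof.
move=> kj jl lJ; have jJ := leq_trans jl lJ.
have j0 : (0 < j)%N by exact: leq_ltn_trans kj.
have pJ : (j.-1 <= J)%N by rewrite (leq_trans (leq_pred _)).
set vj := v K M c n (H j).
have vj0 : 0 < vj by exact: v_gt0.
have q0 : 0 < q l by rewrite exprn_gt0// invr_gt0 exprn_gt0.
(* With the error of size [vj] and the event of order [q l ^+ 2], this weight makes both summands of
   [sqr_event_le_exp] multiples of [q l * vj ^+ 2]. *)
pose eps := q l / vj ^+ 2.
have eps0 : 0 < eps by rewrite divr_gt0// exprn_gt0.
pose lam := ln (hbar / H l).
have lam_ge0 : 0 <= lam by exact: ln_ratio_ge0.
have [nh _ lamn] := log_le_nh n0 hbar0 (Hlow lJ).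
(* Since [j.-1 < l], the two bandwidths differ at least by the factor a. *)
have aH : a * H l <= H j.-1.
  by rewrite -[in leRHS](@levelS _ a hbar j.-1)// prednK// ler_pM2l// Hle.
have th0 : 0 <= tau * Num.sqrt lam / v2 K M c n (H j.-1) (H l).
  by rewrite divr_ge0 ?sqrtr_ge0// mulr_ge0 ?sqrtr_ge0// ltW.
pose th := tau * Num.sqrt lam / v2 K M c n (H j.-1) (H l).
have Hl1 : H l <= 1 by exact: le_trans hbar1.
have [b1 b2] := dev_diff_mgf hK model A2 df M0 fM ZE KB n0 a1 (HG pJ) (HG lJ)
  (H0 l) Hl1 aH lam_ge0 lamn tau0 tau1 Btau.
pose S w := x (H j.-1) w - x (H l) w.
have mS : measurable_fun setT S by apply: measurable_funB; exact: measurable_dev.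
pose g1 w := expR (tau / vj * x (H j) w) + expR (- (tau / vj * x (H j) w)).
pose g2 w := expR (th * S w) + expR (- (th * S w)).
have mg1 : mean_le P g1 (2 * E1) by exact: mean_le_dev.
have mg2 : mean_le P g2 (2 * expR (A * tau ^+ 2 * lam)).
  exact: mean_le_exp_sym.
have v20 : 0 < v2 K M c n (H j.-1) (H l).
  have [+ _] := v2_ge hK c a1 M0 n0 (H0 l) aH.
  rewrite lt0r sqrtr_ge0 andbT => h; apply/eqP => v0; move: h.
  rewrite v0 expr0n /= leNgt => /negP; apply.
  rewrite divr_gt0//; last by rewrite mulr_gt0// ltr0n.
  by rewrite mulr_gt0// mulr_gt0 ?sep_const_gt0// L2sq_gt0.
exists (fun w => eps * (24 / (tau / vj) ^+ 4) * g1 w +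
    eps^-1 * expR (- (th * pw j.-1 l)) * g2 w); last first.
  move=> w; rewrite /rejection_term kj jl /=.
  by apply: sqr_event_le_exp => //; rewrite divr_gt0.
have : mean_le P (fun w => eps * (24 / (tau / vj) ^+ 4) * g1 w +
    eps^-1 * expR (- (th * pw j.-1 l)) * g2 w)
    (eps * (24 / (tau / vj) ^+ 4) * (2 * E1) +
     eps^-1 * expR (- (th * pw j.-1 l)) * (2 * expR (A * tau ^+ 2 * lam))).
  apply: mean_leD; apply: mean_leZ => //.
    by rewrite mulr_ge0 ?(ltW eps0)// divr_ge0// exprn_ge0// divr_ge0// ltW.
  by rewrite mulr_ge0 ?expR_ge0// invr_ge0 ltW.
apply: mean_le_trans.
(* The factor [lambda] in the threshold makes the Chernoff exponent at least
   [tau * Num.sqrt kappa * lam]. After the moment bound is paid, [ktau] leaves [8 * lam], and the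
   exponential of [- lam] is [a^- l]. *)
have decay : expR (- (th * pw j.-1 l)) * expR (A * tau ^+ 2 * lam) <= q l ^+ 2.
  have -> : q l ^+ 2 = expR (- (8 * lam)).
    rewrite /lam ln_level// expRN expRM_natl expRM_natl lnK ?posrE//.
    by rewrite /q !exprVn -!exprM.
  rewrite -expRD ler_expR.
  have : tau * Num.sqrt kappa * lam <= th * pw j.-1 l.
    have -> : th * pw j.-1 l = tau * Num.sqrt lam * lambda kappa hbar (H l).
      by rewrite /th /pw; field; rewrite gt_eqF.
    rewrite -mulrA -[leRHS]mulrA ler_pM2l//.
    apply: (@le_trans _ _ (Num.sqrt lam * Num.sqrt (kappa * lam))).
      by rewrite sqrtrM// mulrCA -expr2 sqr_sqrtr.
    by rewrite ler_wpM2l ?sqrtr_ge0// le_max lexx orbT.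
  by have := ler_wpM2r lam_ge0 ktau; lra.
apply: (@le_trans _ _ (C0 * (q l * vj ^+ 2))).
  have -> : eps * (24 / (tau / vj) ^+ 4) * (2 * E1) =
      (48 * E1 / tau ^+ 4) * (q l * vj ^+ 2).
    by rewrite /eps; field; rewrite !gt_eqF.
  rewrite [leRHS]mulrDl lerD2l.
  rewrite (_ : eps^-1 * _ * _ = 2 * (eps^-1 * (expR (- (th * pw j.-1 l)) *
    expR (A * tau ^+ 2 * lam)))); last by ring.
  rewrite ler_pM2l//; apply: (@le_trans _ _ (eps^-1 * q l ^+ 2)).
    by rewrite ler_wpM2l// invr_ge0 ltW.
  by rewrite /eps le_eqVlt; apply/orP; left; apply/eqP; field; rewrite !gt_eqF.
have C00 : 0 <= C0.
  apply: addr_ge0 => //; apply: divr_ge0; last exact: exprn_ge0 (ltW tau0).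
  by apply: mulr_ge0 => //; exact: expR_ge0.
rewrite -[leRHS]mulrA ler_wpM2l//.
have vscale : vj ^+ 2 <= (H k / H j) ^+ 2 * v K M c n (H k) ^+ 2.
  by apply: v_sqr_scale => //; rewrite Hle ltnW.
have rat : H k / H j <= a ^+ j.
  rewrite ler_pdivrMr// /level mulrA divff ?expf_neq0 ?gt_eqF// mul1r.
  by rewrite ler_piMl ?(ltW hbar0)// invf_le1 ?exprn_gt0// exprn_ege1// ltW.
have rat2 : (H k / H j) ^+ 2 <= (a ^+ j) ^+ 2.
  by rewrite ler_pXn2r// ?nnegrE ?exprn_ge0 ?(ltW a0)// divr_ge0 ?(ltW (H0 _)).
apply: (@le_trans _ _ (q l * ((a ^+ j) ^+ 2 * v K M c n (H k) ^+ 2))).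
  by rewrite ler_pM2l// (le_trans vscale)// ler_wpM2r// sqr_ge0.
rewrite mulrA mulrC ler_wpM2l ?sqr_ge0//.
have y0 : 0 < a^-1 by rewrite invr_gt0.
set p := a^-1 ^+ l; set r := a^-1 ^+ j.
have p0 : 0 < p by exact: exprn_gt0.
have r0 : 0 < r by exact: exprn_gt0.
have pr : p <= r by rewrite ler_wiXn2l ?(ltW y0)// invf_le1// ltW.
have -> : q l = p ^+ 4 by rewrite /q /p [in RHS](exprVn a).
have -> : a ^+ j = r^-1 by rewrite /r exprVn invrK.
rewrite exprVn ler_pdivrMr ?exprn_gt0//.
(* As j <= l gives p <= r, three of the four powers of p are traded for powers of r, two of which
   cancel the variance growth. *)
have p3 : p ^+ 3 <= r ^+ 3 by rewrite ler_pXn2r// nnegrE ltW.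
by rewrite (_ : _ * r ^+ 2 = p * r ^+ 3) 1?exprS ?ler_pM2l//; ring.
Qed.

Lemma hhat_level w : exists jh, [/\ (jh <= J)%N,
  hhat K M c n kappa a hbar (fhat Z) w = H jh,
  forall l, (jh <= l <= J)%N -> `|fhat Z (H jh) w - fhat Z (H l) w| <=
    psi K M c n kappa hbar (H jh) (H l) &
  forall i, (i < jh)%N -> ~ forall l, (i <= l <= J)%N ->
    `|fhat Z (H i) w - fhat Z (H l) w| <= psi K M c n kappa hbar (H i) (H l)].
Proof.
pose Q (h : R) := forall eta, grid a hbar n eta -> eta <= h ->
  `|fhat Z h w - fhat Z eta w| <= psi K M c n kappa hbar h eta.
have QE i : (i <= J)%N -> Q (H i) <-> forall l, (i <= l <= J)%N ->
    `|fhat Z (H i) w - fhat Z (H l) w| <= psi K M c n kappa hbar (H i) (H l).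
  move=> iJ; split=> [Qi l /andP[il lJ]|Qi _ /gridE[l lJ ->]].
    by apply: Qi; [exact: HG|rewrite Hle].
  by rewrite Hle => il; apply: Qi; rewrite il.
(* The smallest bandwidth is always accepted, being compared with itself only, so the maximum is
   over a nonempty set. *)
have [|jh [jhJ Qjh minj supE]] := @sup_grid_level _ a hbar n J Q a1 hbar0 gridE.
  exists J => //; apply/QE => // l lJ.
  have -> : l = J by apply/eqP; rewrite eqn_leq andbC.
  by rewrite subrr normr0 addr_ge0// mulr_ge0 ?sqrtr_ge0.
exists jh; split=> //; first exact/QE.
move=> i ijh Qi; apply: (minj i ijh); apply/QE => //.
by rewrite (leq_trans (ltnW ijh)).
Qed.

(** In the constant, 12 is the product of 3 from [lepski_pointwise], 2 from [sqr_le_exp] and 2 for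
    the two signs; the last term is [C0] times the square of a geometric series. *)
Lemma oracle_bound :
  ('E_P[fun w => ((fhat Z (hhat K M c n kappa a hbar (fhat Z) w) w - f t) ^+ 2)%R]
   <= ((28 + 3 * L ^+ 2 + 12 * E1 / tau ^+ 2 + C0 / (1 - a^-1) ^+ 2) *
       (vl (H k)) ^+ 2)%:E)%E.
Proof.
set vk := v K M c n (H k).
have vk0 : 0 < vk by exact: v_gt0.
have vvl : vk <= vl (H k) by rewrite ler_peMr ?lambda_ge1// ltW.
have a1' := a1.
have y0 : 0 <= a^-1 by rewrite invr_ge0 ltW.
have y1 : a^-1 < 1 by rewrite invf_lt1.
pose b (j l : nat) := C0 * vk ^+ 2 * (a^-1 ^+ j * a^-1 ^+ l).
have C00 : 0 <= C0.
  apply: addr_ge0 => //; apply: divr_ge0; last exact: exprn_ge0 (ltW tau0).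
  by apply: mulr_ge0 => //; exact: expR_ge0.
have b0 j l : 0 <= b j l by rewrite !mulr_ge0 ?exprn_ge0// ltW.
have exg (p : 'I_J.+1 * 'I_J.+1) : exists g, mean_le P g (b p.1 p.2) /\
    forall w, rejection_term k (fun i => x (H i) w) pw p.1 p.2 <= g w.
  case: p => j l /=; have [/andP[kj jl]|njl] := boolP (k < j <= l)%N.
    have [g gb gle] := mean_le_rejection kj jl (leq_ord l).
    by exists g.
  exists (fun=> 0); split; first exact: mean_le_trans (mean_le_cst P (lexx 0)).
  by move=> w; rewrite /rejection_term (negbTE njl).
have [G /all_and2[Gb Gle]] := choice exg.
pose D := 2 / (tau / vk) ^+ 2.
have D0 : 0 <= D by rewrite divr_ge0// exprn_ge0// divr_ge0 ?(ltW tau0) ?(ltW vk0).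
pose Psi w := (28 + 3 * L ^+ 2) * vl (H k) ^+ 2 +
  3 * D * (expR (tau / vk * x (H k) w) + expR (- (tau / vk * x (H k) w))) +
  \sum_(j < J.+1) \sum_(l < J.+1) G (j, l) w.
have Psib : mean_le P Psi ((28 + 3 * L ^+ 2) * vl (H k) ^+ 2 +
  3 * D * (2 * E1) + \sum_(j < J.+1) \sum_(l < J.+1) b j l).
  apply: mean_leD; last first.
    by apply: mean_le_sum => j; apply: mean_le_sum => l; exact: Gb (j, l).
  apply: mean_leD.
    apply: mean_le_cst; rewrite mulr_ge0 ?sqr_ge0//.
    by rewrite addr_ge0// mulr_ge0// sqr_ge0.
  by apply: mean_leZ; [rewrite mulr_ge0|exact: mean_le_dev].
(* The selected estimator is replaced by [Psi] inside the integral; only [Psi] is known to be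
   measurable. *)
rewrite unlock; apply: (@le_trans _ _ (\int[P]_w (Psi w)%:E)%E).
  apply: ge0_le_integral_nomeas => w; first by rewrite lee_fin sqr_ge0.
  rewrite lee_fin; have [jh [jhJ -> ok nok]] := hhat_level w.
  have := @lepski_pointwise R J k jh (fun j => fhat Z (H j) w)
    (fun j => smooth K f (H j) t) (fun j => vl (H j)) pw (f t) L kJ jhJ.
  move=> /(_ _ _ _ _ biask bias ok nok) /le_trans; apply.
  - by move=> j; rewrite mulr_ge0 ?sqrtr_ge0.
  - by move=> j l; rewrite mulr_ge0 ?sqrtr_ge0.
  - move=> j kj; apply: ler_pM; rewrite ?sqrtr_ge0//.
      by apply: v_le => //; rewrite Hle.
    by apply: lambda_le => //; rewrite Hle.
  - by move=> j jk; apply: psi_le => //; rewrite Hle.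
  apply: lerD; first apply: lerD => //.
    rewrite -[leRHS]mulrA ler_pM2l//; apply: sqr_le_exp; exact: divr_gt0.
  by apply: ler_sum => j _; apply: ler_sum => l _; exact: (Gle (j, l)).
case: Psib => _ _ /le_trans; apply; rewrite lee_fin.
have -> : \sum_(j < J.+1) \sum_(l < J.+1) b j l =
    C0 * vk ^+ 2 * (\sum_(j < J.+1) a^-1 ^+ j) ^+ 2.
  exact: sum_square_powers.
have geom : (\sum_(j < J.+1) a^-1 ^+ j) ^+ 2 <= (1 - a^-1)^-1 ^+ 2.
  have S0 : 0 <= \sum_(j < J.+1) a^-1 ^+ j.
    by apply: sumr_ge0 => j _; exact: exprn_ge0.
  have S1 := sum_geom_le J.+1 y0 y1.
  by rewrite ler_pXn2r// nnegrE (le_trans S0).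
have vvl2 : vk ^+ 2 <= vl (H k) ^+ 2.
  by rewrite ler_pXn2r// ?nnegrE ?(ltW vk0)// (le_trans (ltW vk0)).
rewrite [leRHS]mulrDl [X in _ <= X + _]mulrDl; apply: lerD; first apply: lerD => //.
  have -> : 3 * D * (2 * E1) = 12 * E1 / tau ^+ 2 * vk ^+ 2.
    by rewrite /D; field; rewrite !gt_eqF.
  rewrite ler_wpM2l// divr_ge0 ?(exprn_ge0 _ (ltW tau0))// mulr_ge0// expR_ge0//.
rewrite -mulrA mulrC -[leRHS]mulrA -exprVn mulrC ler_wpM2l//.
by rewrite [leRHS]mulrC ler_pM ?sqr_ge0.
Qed.

End OracleBound.

(** * Oracle bandwidth and rate *)

Section OracleBandwidth.
Context {R : realType} (K : R -> R) (hK : is_kernel K).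
Variables (a hbar kappa M L t c : R) (n J : nat) (f : R -> R).
Hypotheses (a1 : 1 < a) (hbar0 : 0 < hbar) (M0 : 0 < M) (n0 : (0 < n)%N)
  (kappa0 : 0 <= kappa).
Hypotheses (lowJ : hlow hbar n <= level a hbar J)
  (Jlow : level a hbar J.+1 < hlow hbar n)
  (gridE : forall h, grid a hbar n h <->
     exists2 j, (j <= J)%N & h = level a hbar j).
Hypothesis init : initial_bias_le L K M c n kappa a hbar f t.

Local Notation H := (level a hbar).
Local Notation vl h := (v K M c n h * lambda kappa hbar h).
Local Notation hs := (hstar K M c n kappa a hbar f t).

Let vl0 h : 0 <= vl h.
Proof. by rewrite mulr_ge0 ?sqrtr_ge0// (le_trans _ (lambda_ge1 _ _ _)). Qed.
Let a0 : 0 < a. Proof. exact: lt_trans a1. Qed.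
Let low0 : 0 < hlow hbar n. Proof. exact: hlow_gt0. Qed.
Let Hbar j : H j <= hbar.
Proof. exact: level_le_top. Qed.

(** If the oracle set is nonempty, [hs] is level k itself. Otherwise [hs] is [hlow], possibly off
    the grid: then k = J, the bias there is controlled by [init], and the third claim is vacuous.
    The factor [|L| + 1/2] covers both cases. *)
Lemma hstar_level : exists k, [/\ (k <= J)%N,
  `|smooth K f (H k) t - f t| <= (`|L| + 1 / 2) * vl (H k),
  (k < J)%N -> forall l, (k <= l <= J)%N ->
     `|smooth K f (H l) t - f t| <= vl (H k) / 2 &
  hlow hbar n <= hs <= H k].
Proof.
pose Q h := forall eta, grid a hbar n eta -> eta <= h ->
  `|smooth K f eta t - f t| <= vl h / 2.
rewrite /hstar; case: pselect => [[h [Gh Qh]]|empty].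
  have [|k [kJ Qk _ supE]] := @sup_grid_level _ a hbar n J Q a1 hbar0 gridE.
    by have /gridE[j jJ hE] := Gh; exists j => //; rewrite -hE.
  exists k; rewrite /oracle_set supE lexx andbT; split=> //.
  - have := Qk (H k) _ (lexx _); rewrite {1}gridE => /(_ _)/le_trans; apply.
      by exists k.
    by rewrite mulrC ler_wpM2r// ; have := normr_ge0 L; lra.
  - by move=> _ l /andP[kl lJ]; apply: Qk; [apply/gridE; exists l|exact: level_le].
  - by rewrite (le_trans lowJ)// level_le.
exists J; split=> //; last by rewrite lexx.
- have GJ : grid a hbar n (H J) by apply/gridE; exists J.
  have := init GJ; move=> /(_ _)/le_trans; apply.
    by move=> _ /gridE[j jJ ->]; exact: level_le.
  by rewrite ler_wpM2r//; have := ler_norm L; lra.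
- by rewrite ltnn.
Qed.

(** The oracle condition fails just above [hs]: g is the next level, [a * hs], or, if the oracle set
    is empty, the smallest level, which lies within a factor a of [hlow]. *)
Lemma hstar_next : a * hs < hbar -> exists g eta,
  [/\ hs <= g <= a * hs, g <= hbar, 0 < eta <= g &
     vl g / 2 < `|smooth K f eta t - f t|].
Proof.
pose Q h := forall eta, grid a hbar n eta -> eta <= h ->
  `|smooth K f eta t - f t| <= vl h / 2.
have notQ j : (j <= J)%N -> ~ Q (H j) -> exists2 eta, 0 < eta <= H j &
     vl (H j) / 2 < `|smooth K f eta t - f t|.
  move=> jJ nQ; apply: contrapT => no; apply: nQ => eta Geta etaj.
  rewrite leNgt; apply/negP => lt; apply: no; exists eta => //.
  by rewrite etaj andbT; have /gridE[i _ ->] := Geta; exact: level_gt0.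
rewrite /hstar; case: pselect => [[h [Gh Qh]]|empty].
  have [|k [kJ Qk mink supE]] := @sup_grid_level _ a hbar n J Q a1 hbar0 gridE.
    by have /gridE[j jJ hE] := Gh; exists j => //; rewrite -hE.
  rewrite /oracle_set supE; case: k kJ Qk mink supE => [|k] kJ Qk mink supE.
    (* Index 0 would mean [hs = hbar], against the assumption [a * hs < hbar]. *)
    rewrite /level expr0 invr1 mul1r ltNge => /negP[].
    by rewrite ler_peMl// ltW.
  have [eta eta0 far] := notQ k (ltnW kJ) (mink k (ltnSn k)).
  move=> _; exists (H k), eta; split=> //.
  by rewrite levelS// lexx andbT level_le.
have [eta eta0 far] : exists2 eta, 0 < eta <= H J &
     vl (H J) / 2 < `|smooth K f eta t - f t|.
  apply: notQ => // QJ; apply: empty; exists (H J); split=> //.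
  by apply/gridE; exists J.
move=> _; exists (H J), eta; split=> //.
by rewrite lowJ -(@levelS _ a hbar J)// ler_pM2l// ltW.
Qed.

End OracleBandwidth.

(** * Comparison of the oracle bound with the rate *)

Section Rate.
Context {R : realType} (K : R -> R) (hK : is_kernel K).
Variables (a kappa M L t c : R) (n : nat) (f : R -> R).
Hypotheses (a1 : 1 < a) (M0 : 0 < M) (n1 : (1 < n)%N) (kappa0 : 0 <= kappa).
Hypothesis grid0 : grid a 1 n !=set0.

Local Notation hs := (hstar K M c n kappa a 1 f t).

Let n0 : (0 < n)%N. Proof. exact: ltn_trans n1. Qed.

(** Being bounded away from 0 for n at least 2, the logarithm in the rate absorbs the 1 in
    [lambda]. *)
Lemma ln_nat_ge_half : 1 / 2 <= ln n%:R :> R.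
Proof.
have N0 : 0 < n%:R :> R by rewrite ltr0n.
rewrite -ler_expR lnK ?posrE//.
have : expR (1 / 2) <= 1 + 1 / 2 + 2 * (1 / 2) ^+ 2 :> R by apply: expR_le_quad; lra.
have : 2 <= n%:R :> R by rewrite ler_nat.
set e := expR _; lra.
Qed.

(** One summand for each case of [hstar_le_rate]: [h <= a * hs] and [a * hs < h]. *)
Definition rate_const : R :=
  a ^+ 2 * (2 + kappa) + 4 * a ^+ 2 * (1 + kappa * ln a).

Lemma rate_const_gt0 : 0 < rate_const.
Proof.
have la : 0 <= ln a by rewrite ln_ge0// ltW.
have a2 : 0 < a ^+ 2 by rewrite exprn_gt0// (lt_trans _ a1).
have kla : 0 <= kappa * ln a by rewrite mulr_ge0.
by apply: addr_gt0; apply: mulr_gt0 => //; have := kappa0; lra.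
Qed.

Lemma lambda_sqr_le_log h : hlow 1 n <= h -> h <= 1 ->
  lambda kappa 1 h ^+ 2 <= (2 + kappa) * ln n%:R.
Proof.
move=> lowh h1; have h0 : 0 < h by apply: lt_le_trans lowh; exact: hlow_gt0.
have [_ lnh _] := log_le_nh n0 ltr01 lowh.
rewrite lambda_sqr// ge_max.
have half := ln_nat_ge_half; have k0 := kappa0.
have kl : 0 <= kappa * ln n%:R by rewrite mulr_ge0//; lra.
have lnE : ln (1 * Num.sqrt n%:R) = ln n%:R / 2 :> R.
  rewrite mul1r; apply: (@mulIf _ 2) => //; rewrite divfK//.
  rewrite mulr_natr -lnXn ?sqrtr_gt0 ?ltr0n//.
  by rewrite sqr_sqrtr.
rewrite lnE in lnh; have := ler_wpM2l k0 lnh.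
rewrite mulrDl; move: kl half; set l := ln n%:R => ? ?; rewrite mulrA => ?.
by apply/andP; split; lra.
Qed.

(** If [h <= a * hs], the variance term of the rate at h dominates. Otherwise the oracle condition
    fails at some g below h, and the bias that violates it, which the supremum sees, exceeds half of
    [v] times [lambda] at g. *)
Lemma hstar_le_rate h : initial_bias_le L K M c n kappa a 1 f t ->
  hlow 1 n <= h -> h <= 1 ->
  ((v K M c n hs ^+ 2 * lambda kappa 1 hs ^+ 2 / rate_const)%:E <=
   ereal_sup [set ((smooth K f eta t - f t) ^+ 2)%:E | eta in `[0%R, h]] +
   (M * L2sq K * ln n%:R / (n%:R * h) +
    c ^+ 2 * ln n%:R / (n%:R * h ^+ 2))%:E)%E.
Proof.
move=> init lowh h1.
have [J [lowJ Jlow gridE]] := grid_levels a1 n0 grid0.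
have [k [kJ _ _ /andP[lowhs hsk]]] :=
  hstar_level a1 ltr01 lowJ gridE init.
have a0 : 0 < a by exact: lt_trans a1.
have h0 : 0 < h by apply: lt_le_trans lowh; exact: hlow_gt0.
have hs0 : 0 < hs by apply: lt_le_trans lowhs; exact: hlow_gt0.
have hs1 : hs <= 1.
  by apply: le_trans hsk _; exact: level_le_top.
have N0 : 0 < n%:R :> R by rewrite ltr0n.
have Cr0 := rate_const_gt0.
set SUP := ereal_sup _.
have half := ln_nat_ge_half.
have VrE : M * L2sq K * ln n%:R / (n%:R * h) + c ^+ 2 * ln n%:R / (n%:R * h ^+ 2)
   = v K M c n h ^+ 2 * ln n%:R.
  by rewrite v_sqr ?(ltW M0) ?(ltW h0)//; ring.
rewrite VrE.
have la : 0 <= ln a by rewrite ln_ge0// ltW.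
have kla : 0 <= kappa * ln a by rewrite mulr_ge0.
have a20 : 0 < a ^+ 2 by rewrite exprn_gt0.
have Vr0 : 0 <= v K M c n h ^+ 2 * ln n%:R.
  by rewrite mulr_ge0 ?sqr_ge0//; lra.
have vratio g x : 0 < x -> x <= a * g -> 0 < g ->
    v K M c n g ^+ 2 <= a ^+ 2 * v K M c n x ^+ 2.
  move=> x0 xag g0; have [gx|xg] := leP g x.
    apply: le_trans (v_sqr_scale hK c M0 n0 g0 gx) _.
    have xg0 : 0 <= x / g by rewrite divr_ge0// ltW.
    by rewrite ler_wpM2r ?sqr_ge0// ler_pXn2r ?nnegrE ?(ltW a0)// ler_pdivrMr.
  apply: (@le_trans _ _ (v K M c n x ^+ 2)).
    by rewrite ler_pXn2r// ?nnegrE ?sqrtr_ge0// v_le// ltW.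
  by rewrite ler_peMl ?sqr_ge0// exprn_ege1// ltW.
have [hahs|ahsh] := leP h (a * hs).
  (* The supremum includes eta = 0, where the convention in [smooth] makes the bias vanish. *)
  have SUP0 : (0 <= SUP)%E.
    apply: ereal_sup_ubound; exists 0; first by rewrite /= in_itv /= lexx ltW.
    by rewrite /smooth eqxx subrr expr0n.
  apply: (@le_trans _ _ (v K M c n h ^+ 2 * ln n%:R)%:E); last first.
    by rewrite leeDr.
  rewrite lee_fin ler_pdivrMr//.
  apply: (@le_trans _ _ (a ^+ 2 * v K M c n h ^+ 2 * ((2 + kappa) * ln n%:R))).
    apply: ler_pM; rewrite ?sqr_ge0//; first exact: vratio.
    exact: lambda_sqr_le_log.
  rewrite (_ : _ * _ = (v K M c n h ^+ 2 * ln n%:R) * (a ^+ 2 * (2 + kappa))).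
    rewrite ler_wpM2l// /rate_const lerDl mulr_ge0// ?addr_ge0//.
    by rewrite mulr_ge0// ltW.
  by ring.
have [|g [eta [/andP[hsg gahs] g1 /andP[eta0 etag] far]]] :=
  hstar_next a1 ltr01 lowJ Jlow gridE (kappa := kappa) (M := M) (K := K) (t := t)
    (c := c) (f := f); first exact: lt_le_trans h1.
have g0 := lt_le_trans hs0 hsg.
set vg := v K M c n g * lambda kappa 1 g in far.
have vg0 : 0 <= vg.
  by rewrite mulr_ge0 ?sqrtr_ge0// (le_trans _ (lambda_ge1 _ _ _)).
have SUPg : ((vg ^+ 2 / 4)%:E <= SUP)%E.
  apply: (@le_trans _ _ ((smooth K f eta t - f t) ^+ 2)%:E).
    rewrite lee_fin (_ : vg ^+ 2 / 4 = (vg / 2) ^+ 2); last by field.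
    rewrite -[leRHS]real_normK ?num_real// ler_pXn2r ?nnegrE//.
      exact: ltW.
    by rewrite divr_ge0.
  apply: ereal_sup_ubound; exists eta => //; rewrite /= in_itv /= (ltW eta0) /=.
  by rewrite (le_trans etag)// (le_trans gahs)// ltW.
apply: (@le_trans _ _ (vg ^+ 2 / 4)%:E); last first.
  by apply: (le_trans SUPg); rewrite leeDl// lee_fin.
rewrite lee_fin ler_pdivrMr//.
(* As [g <= a * hs], the logarithm grows by at most [ln a] from g to [hs]. *)
have lam : lambda kappa 1 hs ^+ 2 <= (1 + kappa * ln a) * lambda kappa 1 g ^+ 2.
  have k0 := kappa0; rewrite !lambda_sqr//.
  have lnhs : ln (1 / hs) <= ln (1 / g) + ln a.
    have hsV0 : 0 < hs^-1 by rewrite invr_gt0.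
    have gV0 : 0 < g^-1 by rewrite invr_gt0.
    rewrite !mul1r -lnM ?posrE// ler_ln ?posrE ?mulr_gt0//.
    by rewrite mulrC ler_pdivlMr// mulrC ler_pdivrMr.
  have := ler_wpM2l k0 lnhs; rewrite mulrDr.
  set p := kappa * ln (1 / g); set q := kappa * ln (1 / hs) => qp.
  have m1 : 1 <= Num.max 1 p by rewrite le_max lexx.
  have mp : p <= Num.max 1 p by rewrite le_max lexx orbT.
  move: m1 mp kla qp; set m := Num.max 1 p; set y := kappa * ln a => m1 mp y0 qp.
  by rewrite ge_max; apply/andP; split; nra.
apply: (@le_trans _ _ ((a ^+ 2 * v K M c n g ^+ 2) *
    ((1 + kappa * ln a) * lambda kappa 1 g ^+ 2))).
  by apply: ler_pM; rewrite ?sqr_ge0//; exact: vratio.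
rewrite (_ : _ * _ = vg ^+ 2 / 4 * (4 * a ^+ 2 * (1 + kappa * ln a))).
  rewrite ler_wpM2l ?divr_ge0 ?sqr_ge0// /rate_const lerDr.
  by rewrite mulr_ge0 ?(ltW a20)// addr_ge0.
by rewrite /vg; field.
Qed.

End Rate.

Theorem theorem4p3 (R : realType) (K : R -> R) (Delta a M : R)
  (hK : is_kernel K) (ha : 1 < a) (hM : 0 < M) :
  exists kappa0 : R, forall kappa L : R, kappa0 <= kappa ->
  exists C1 C2 : R, 0 < C1 /\ 0 < C2 /\
  forall (m : mechanism) (alpha beta : R) (n : nat) (hbar t : R) (f : R -> R)
    (d : measure_display) (T : measurableType d) (P : probability T R)
    (X : 'I_n -> {RV P >-> R}) (Z : 'I_n -> R -> T -> R),
  let Hn := grid a hbar n in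
  let alpha' := alpha / (grid_card a hbar n)%:R in
  let beta' := beta / (grid_card a hbar n)%:R in
  let c := noise_const m K Delta alpha' beta' in
  let ftilde := fun w => fhat Z (hhat K M c n kappa a hbar (fhat Z) w) w in
  let hs := hstar K M c n kappa a hbar f t in
  (0 < n)%N ->
  a * ln (hbar * Num.sqrt n%:R) / Num.sqrt n%:R <= hbar <= 1 ->
  Hn !=set0 ->
  admissible m K Delta alpha beta ->
  is_density f -> (forall x, f x <= M) ->
  iid_sample f X ->
  private_observations m Hn K c t X Z ->
  initial_bias_le L K M c n kappa a hbar f t ->
  ('E_P[fun w => ((ftilde w - f t) ^+ 2)%R]
     <= (C1 * ((v K M c n hs) ^+ 2 * (lambda kappa hbar hs) ^+ 2))%:E)%E
  /\
  ((1 < n)%N -> hbar = 1 ->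
   ('E_P[fun w => ((ftilde w - f t) ^+ 2)%R]
      <= C2%:E * rate K M c n f t)%E).
Proof.
have [B KB] := kernel_bounded hK.
have L20 := L2sq_gt0 hK.
have sep0 := sep_const_gt0 ha.
pose A := Num.max 2 (K 0).
have A2 : 2 <= A by rewrite le_max lexx.
pose s := M * (sep_const a * L2sq K).
have s0 : 0 < s by rewrite mulr_gt0// mulr_gt0.
have B20 : 0 <= 16 * B ^+ 2 by rewrite mulr_ge0// sqr_ge0.
(* Chosen for [Btau], using [tau ^+ 2 <= tau]; the added 1 keeps the denominator positive for any
   B. *)
pose tau := Num.min 1 (s / (16 * B ^+ 2 + 1)).
have tau0 : 0 < tau.
  by rewrite lt_min ltr01 /= divr_gt0//; lra.
have tau1 : tau <= 1 by rewrite ge_min lexx.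
have Btau : 16 * B ^+ 2 * tau ^+ 2 <= s.
  apply: (@le_trans _ _ (16 * B ^+ 2 * tau)).
    by rewrite ler_wpM2l// expr2 ler_piMr// ltW.
  apply: (@le_trans _ _ ((16 * B ^+ 2 + 1) * tau)).
    by rewrite [leRHS]mulrDl lerDl mul1r ltW.
  rewrite mulrC -ler_pdivlMr; last by lra.
  by rewrite ge_min lexx orbT.
(* The least square root of [kappa] compatible with [ktau]. *)
pose q := (8 + A * tau ^+ 2) / tau.
have q0 : 0 <= q.
  rewrite divr_ge0 ?(ltW tau0)// addr_ge0// mulr_ge0 ?sqr_ge0//; lra.
exists (q ^+ 2) => kappa L kq.
have kappa0 : 0 <= kappa by apply: le_trans kq; exact: sqr_ge0.
have ktau : 8 + A * tau ^+ 2 <= tau * Num.sqrt kappa.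
  rewrite [leRHS]mulrC -ler_pdivrMr// -/q -[q]ger0_norm// -sqrtr_sqr.
  exact: ler_wsqrtr.
pose E1 := expR (A * tau ^+ 2).
have E10 : 0 <= E1 by exact: expR_ge0.
pose C1 := 28 + 3 * (`|L| + 1 / 2) ^+ 2 + 12 * E1 / tau ^+ 2 +
  (48 * E1 / tau ^+ 4 + 2) / (1 - a^-1) ^+ 2.
have a10 : 0 < 1 - a^-1 by rewrite subr_gt0 invf_lt1//; lra.
have C10 : 0 < C1.
  have t2 := exprn_gt0 2 tau0; have t4 := exprn_gt0 4 tau0.
  have x1 : 0 <= 3 * (`|L| + 1 / 2) ^+ 2 by rewrite mulr_ge0// sqr_ge0.
  have x2 : 0 <= 12 * E1 / tau ^+ 2 by rewrite divr_ge0 ?(ltW t2)// mulr_ge0.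
  have x3 : 0 <= (48 * E1 / tau ^+ 4 + 2) / (1 - a^-1) ^+ 2.
    by rewrite divr_ge0 ?sqr_ge0// addr_ge0// divr_ge0 ?(ltW t4)// mulr_ge0.
  by rewrite /C1; lra.
have Cr0 := rate_const_gt0 ha kappa0.
exists C1; exists (C1 * rate_const a kappa); split; first exact: C10.
split; first exact: mulr_gt0.
move=> m alpha beta n hbar t f d T P X Z Hn alpha' beta' c ftilde hs
  n0 /andP[_ hbar1] Hn0 adm df fM iid obs init.
have low0 := hlow_gt0 hbar n0.
have hbar0 : 0 < hbar by exact: lt_le_trans (grid_hlow_le Hn0).
have [W model ZE] := private_observations_noise_model adm iid obs.
have [J [lowJ Jlow gridE]] := grid_levels ha n0 Hn0.
have [k [kJ biask bias /andP[lowhs hsk]]] :=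
  hstar_level ha hbar0 lowJ gridE init.
have hs0 : 0 < hs by exact: lt_le_trans lowhs.
have bound : ('E_P[fun w => ((ftilde w - f t) ^+ 2)%R]
     <= (C1 * ((v K M c n hs) ^+ 2 * (lambda kappa hbar hs) ^+ 2))%:E)%E.
  have := @oracle_bound R K hK d T P a hbar kappa tau A M B (`|L| + 1 / 2) t c
    n J k f (fun i => X i : T -> R) W Z ha hbar0 hbar1 lowJ gridE model A2 df hM
    fM ZE KB n0 tau0 tau1 Btau kappa0 ktau kJ biask bias.
  (* The bound at level k passes to [hs] because [hs <= level a hbar k] and both [v] and [lambda]
     are nonincreasing in the bandwidth. *)
  move=> /le_trans; apply; rewrite lee_fin -/E1 -/C1 ler_pM2l// -exprMn.
  have vl0 h : 0 <= v K M c n h * lambda kappa hbar h.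
    by rewrite mulr_ge0 ?sqrtr_ge0// (le_trans _ (lambda_ge1 _ _ _)).
  rewrite ler_pXn2r// ?nnegrE// ler_pM ?sqrtr_ge0//.
  - by rewrite (le_trans _ (lambda_ge1 _ _ _)).
  - exact: v_le.
  - exact: lambda_le.
split=> // n1 hbarE; subst hbar.
apply: (le_trans bound).
set X2 := v K M c n hs ^+ 2 * lambda kappa 1 hs ^+ 2.
have -> : (C1 * X2)%:E = ((C1 * rate_const a kappa)%:E * (X2 / rate_const a kappa)%:E)%E.
  by rewrite -EFinM; congr EFin; field; rewrite gt_eqF.
rewrite lee_pmul2l ?lte_fin ?mulr_gt0//.
apply/ereal_infP => y [h /=]; rewrite in_itv /= => /andP[lowh h1] <-.
exact: (@hstar_le_rate R K hK a kappa M L t c n f ha hM n1 kappa0 Hn0 h init lowh h1).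
Qed.
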